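(* For each $1\le n\le\omega$, the equivalence relation $=^{+n}$ is in the spectrum of the meager ideal; that is, there is an equivalence relation $F$ on a Polish space $Y$ such that $F$ and $=^{+n}$ are Borel bireducible and for every non-meager (Borel) set $C\subseteq Y$, $F\restriction C$ is Borel bireducible with $F$.
   Context: Friedman–Stanley jumps: for an equivalence relation $E$ on $X$, $E^+$ on $X^{\mathbb N}$ is $x\mathrel{E^+}y\iff\{[x(i)]_E:i\in\mathbb N\}=\{[y(i)]_E:i\in\mathbb N\}$. $=^{+0}$ is equality on $\mathbb R$, $=^{+(n+1)}=(=^{+n})^+$, and $=^{+\omega}=\prod_{n<\omega}=^{+n}$ (product equivalence relation on the product of the domains: coordinatewise equivalence). $E\le_B F$ means there is a Borel reduction; Borel bireducible means $\le_B$ in both directions. *)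

(* Defs.v *)
From HB Require Import structures.
From mathcomp Require Import all_boot all_order all_algebra.
From mathcomp Require Import all_classical all_reals all_analysis.
From mathcomp Require Import Rstruct Rstruct_topology.
Set Implicit Arguments. Unset Strict Implicit. Unset Printing Implicit Defensive.
Import Order.TTheory GRing.Theory Num.Theory.
Local Open Scope classical_set_scope.
Local Open Scope ring_scope.
Local Notation R := Rdefinitions.R.

Definition separable (T : topologicalType) : Prop :=
  exists D : set T, countable D /\ closure D = setT.

Definition is_metric (T : Type) (d : T -> T -> R) : Prop :=
  (forall x y, 0 <= d x y) /\ (forall x y, d x y = 0 <-> x = y) /\
  (forall x y, d x y = d y x) /\ (forall x y z, d x z <= d x y + d y z).

Definition metric_compatible (T : topologicalType) (d : T -> T -> R) : Prop :=
  forall A : set T, open A <->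
    (forall x, A x -> exists e : R, 0 < e /\ [set y | d x y < e] `<=` A).

Definition metric_complete (T : Type) (d : T -> T -> R) : Prop :=
  forall u : nat -> T,
    (forall e : R, 0 < e -> exists N : nat, forall m n : nat, (N <= m)%N -> (N <= n)%N ->
        d (u m) (u n) < e) ->
    exists l : T, forall e : R, 0 < e -> exists N : nat, forall n : nat, (N <= n)%N ->
        d (u n) l < e.

Definition polish (T : topologicalType) : Prop :=
  separable T /\
  exists d : T -> T -> R, is_metric d /\ metric_compatible d /\ metric_complete d.

Definition borel (T : topologicalType) (A : set T) : Prop :=
  <<s (@open T) >> A.

Definition borel_fun (X Y : topologicalType) (f : X -> Y) : Prop :=
  forall B : set Y, borel B -> borel (f @^-1` B).

Definition nowhere_dense (T : topologicalType) (A : set T) : Prop :=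
  interior (closure A) = set0.

Definition meager (T : topologicalType) (A : set T) : Prop :=
  exists F : nat -> set T, (forall n, nowhere_dense (F n)) /\
    A `<=` \bigcup_n F n.

Definition equivalence_rel (X : Type) (E : X -> X -> Prop) : Prop :=
  (forall x, E x x) /\ (forall x y, E x y -> E y x) /\
  (forall x y z, E x y -> E y z -> E x z).

Definition borel_reducible (X Y : topologicalType)
    (E : X -> X -> Prop) (F : Y -> Y -> Prop) : Prop :=
  exists f : X -> Y, borel_fun f /\ forall x y, E x y <-> F (f x) (f y).

Definition borel_bireducible (X Y : topologicalType)
    (E : X -> X -> Prop) (F : Y -> Y -> Prop) : Prop :=
  borel_reducible E F /\ borel_reducible F E.

(** Borel reducibility for the restriction F|C of F to a Borel set C
    (C carries the relative Borel structure; since C is Borel, Borel maps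
    on C are exactly restrictions of Borel maps on the whole space,
    and Borel maps into C are exactly Borel maps with range in C). *)
Definition borel_reducible_restr_to (X Y : topologicalType)
    (F : X -> X -> Prop) (C : set X) (E : Y -> Y -> Prop) : Prop :=
  exists f : X -> Y, borel_fun f /\
    forall x y, C x -> C y -> (F x y <-> E (f x) (f y)).

Definition borel_reducible_to_restr (X Y : topologicalType)
    (E : Y -> Y -> Prop) (F : X -> X -> Prop) (C : set X) : Prop :=
  exists f : Y -> X, borel_fun f /\ (forall y, C (f y)) /\
    forall x y, E x y <-> F (f x) (f y).

Definition borel_bireducible_restr (X : topologicalType)
    (F : X -> X -> Prop) (C : set X) : Prop :=
  borel_reducible_restr_to F C F /\ borel_reducible_to_restr F F C.

Definition fs_jump (X : Type) (E : X -> X -> Prop) (x y : nat -> X) : Prop :=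
  range (fun i => [set z | E (x i) z]) = range (fun i => [set z | E (y i) z]).

Fixpoint plus_space (n : nat) : topologicalType :=
  match n with
  | 0 => (R : topologicalType)
  | m.+1 => (prod_topology (fun _ : nat => plus_space m) : topologicalType)
  end.

Fixpoint eq_plus (n : nat) : plus_space n -> plus_space n -> Prop :=
  match n return plus_space n -> plus_space n -> Prop with
  | 0 => fun x y => x = y
  | m.+1 => fun x y => @fs_jump (plus_space m) (@eq_plus m) x y
  end.

Definition plus_omega_space : topologicalType :=
  prod_topology (fun n : nat => plus_space n).

Definition eq_plus_omega (x y : plus_omega_space) : Prop :=
  forall n : nat, @eq_plus n (x n) (y n).

Definition in_meager_spectrum (X : topologicalType) (E : X -> X -> Prop) : Prop :=
  exists (Y : topologicalType) (F : Y -> Y -> Prop),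
    polish Y /\ equivalence_rel F /\ borel_bireducible F E /\
    forall C : set Y, borel C -> ~ meager C -> borel_bireducible_restr F C.

(* Main.v *)
(** Points of the Polish space [lstruct] code layered structures: level 0 is a
    sequence of reals, and every element of level [k.+1] is a set of elements of
    level [k]. Decoding level [k] yields a point of [plus_space k.+1], and the
    equivalence relation is the pullback of [eq_plus] along the decoding (all
    levels at once for [omega]).

    A non-meager Borel set contains all sufficiently generic structures meeting an
    open set, so a given [z] must be coded, invariantly, by a structure having a
    generic enumeration. A finite condition can be met as soon as the labels are
    jointly generic and the structure is random: every finite pattern of
    memberships is realized, by elements with dense labels. Both are arranged
    canonically from [z]. An element is a finite tuple of hereditary members of [z]
    together with an integer, and membership between two elements depends only on
    the integers and on which entries are equal to, or members of, one another;
    this is Hausdorff's independent family, and distinct sets behave independently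
    because finitely many of their members tell them apart. The label of an element
    of level 0 is read off a perfect set of mutually generic reals. Greedily chosen
    enumerations are Borel in [z], and [z] is recovered from the decoded levels by
    induction on the rank. *)

From HB Require Import structures.
Require Import Defs.
From mathcomp Require Import all_boot all_order all_algebra.
From mathcomp Require Import all_classical all_reals all_analysis.
From mathcomp Require Import Rstruct Rstruct_topology.
From mathcomp Require Import zify ring lra.
Set Implicit Arguments. Unset Strict Implicit. Unset Printing Implicit Defensive.
Import Order.TTheory GRing.Theory Num.Theory.
Local Open Scope classical_set_scope.
Local Notation R := Rdefinitions.R.

(** * Borel sets and Borel functions *)

Lemma borel_open (T : topologicalType) (A : set T) : open A -> borel A.
Proof. by move=> oA; apply: sub_sigma_algebra. Qed.

Lemma borel_setC (T : topologicalType) (A : set T) : borel A -> borel (~` A).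
Proof.
by move=> bA; have [_ + _] := smallest_sigma_algebra setT (@open T) => /(_ _ bA);
  rewrite setTD.
Qed.

Lemma borel_bigcup (T : topologicalType) (I : countType) (A : I -> set T) :
  (forall i, borel (A i)) -> borel (\bigcup_i A i).
Proof.
move=> bA; have [b0 _ bU] := smallest_sigma_algebra setT (@open T).
have -> : \bigcup_i A i =
    \bigcup_n (if @unpickle I n is Some i then A i else set0).
  apply/seteqP; split=> [x [i _ Aix]|x [n _]].
    by exists (pickle i) => //; rewrite pickleK.
  by case: unpickle => // i Aix; exists i.
by apply: bU => n; case: unpickle => [i|]; [exact: bA|exact: b0].
Qed.

Lemma borel_not (T : topologicalType) (P : T -> Prop) :
  borel [set x | P x] -> borel [set x | ~ P x].
Proof. exact: borel_setC. Qed.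

Lemma borel_exists (T : topologicalType) (I : countType) (P : I -> T -> Prop) :
  (forall i, borel [set x | P i x]) -> borel [set x | exists i, P i x].
Proof.
move=> bP; have -> : [set x | exists i, P i x] = \bigcup_i [set x | P i x].
  by apply/seteqP; split=> [x [i Pix]|x [i _ Pix]]; exists i.
exact: borel_bigcup.
Qed.

Lemma borel_forall (T : topologicalType) (I : countType) (P : I -> T -> Prop) :
  (forall i, borel [set x | P i x]) -> borel [set x | forall i, P i x].
Proof.
move=> bP.
have -> : [set x | forall i, P i x] = [set x | ~ exists i, ~ P i x].
  apply/seteqP; split=> [x Px [i]|x nPx i]; first by apply; exact: Px.
  by apply: contrapT => nPix; apply: nPx; exists i.
by apply: borel_not; apply: borel_exists => i; apply: borel_not.
Qed.

Lemma borel_or (T : topologicalType) (P Q : T -> Prop) :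
  borel [set x | P x] -> borel [set x | Q x] -> borel [set x | P x \/ Q x].
Proof.
move=> bP bQ.
have -> : [set x | P x \/ Q x] = [set x | exists b : bool, if b then P x else Q x].
  apply/seteqP; split=> [x []|x [[]]]; [by exists true|by exists false|by left|by right].
by apply: borel_exists; case.
Qed.

Lemma borel_and (T : topologicalType) (P Q : T -> Prop) :
  borel [set x | P x] -> borel [set x | Q x] -> borel [set x | P x /\ Q x].
Proof.
move=> bP bQ.
have -> : [set x | P x /\ Q x] = [set x | forall b : bool, if b then P x else Q x].
  apply/seteqP; split=> [x [? ?] []//|x H]; by split; [exact: (H true)|exact: (H false)].
by apply: borel_forall; case.
Qed.

Lemma borel_imply (T : topologicalType) (P Q : T -> Prop) :
  borel [set x | P x] -> borel [set x | Q x] -> borel [set x | P x -> Q x].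
Proof.
move=> bP bQ.
have -> : [set x | P x -> Q x] = [set x | ~ P x \/ Q x].
  apply/seteqP; split=> [x H|x [nP /nP//|+ _]//].
  by have [/H|] := pselect (P x); [right|left].
by apply: borel_or => //; apply: borel_not.
Qed.

Lemma borel_const (T : topologicalType) (P : Prop) : borel [set _ : T | P].
Proof.
have [p|np] := pselect P.
  by have -> : [set _ : T | P] = setT; [apply/seteqP; split|exact: (borel_open openT)].
by have -> : [set _ : T | P] = set0; [apply/seteqP; split|exact: borel_open open0].
Qed.

Lemma borel_fun_comp (X Y Z : topologicalType) (f : X -> Y) (g : Y -> Z) :
  borel_fun f -> borel_fun g -> borel_fun (g \o f).
Proof. by move=> bf bg B /bg/bf. Qed.

Lemma borel_fun_id (X : topologicalType) : borel_fun (@id X).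
Proof. by []. Qed.

Lemma borel_fun_cst (X Y : topologicalType) (y : Y) : borel_fun (fun _ : X => y).
Proof. by move=> B _; exact: borel_const. Qed.

Lemma borel_fun_if (X Y : topologicalType) (P : X -> bool) (f g : X -> Y) :
  borel [set x | P x] -> borel_fun f -> borel_fun g ->
  borel_fun (fun x => if P x then f x else g x).
Proof.
move=> bP bf bg B bB.
have -> : (fun x => if P x then f x else g x) @^-1` B =
    [set x | (P x -> B (f x)) /\ (~ P x -> B (g x))].
  apply/seteqP; split=> x /=; case: (P x) => //; try by split.
    by case=> + _; apply.
  by case=> _; apply.
apply: borel_and; apply: borel_imply.
- exact: bP.
- exact: bf.
- exact: borel_not.
- exact: bg.
Qed.

Lemma borel_fun_open (X Y : topologicalType) (f : X -> Y) :
  (forall B, open B -> borel (f @^-1` B)) -> borel_fun f.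
Proof.
move=> fo; suff H : <<s (@open Y) >> `<=` [set B | borel (f @^-1` B)] by [].
apply: smallest_sub => //; split.
- rewrite /= preimage_set0; apply: borel_open; exact: open0.
- by move=> A /= /borel_setC; rewrite setTD preimage_setC.
- move=> A bA /=; rewrite preimage_bigcup; exact: borel_bigcup.
Qed.

Lemma borel_fun_continuous (X Y : topologicalType) (f : X -> Y) :
  continuous f -> borel_fun f.
Proof.
move=> /continuousP fc; apply: borel_fun_open => B oB; apply: borel_open; exact: fc.
Qed.

Definition countably_based (T : topologicalType) :=
  exists (I : countType) (B : I -> set T), (forall i, open (B i)) /\
    forall (A : set T) x, open A -> A x -> exists i, B i x /\ B i `<=` A.

Lemma borel_fun_base (X Y : topologicalType) (I : countType) (B : I -> set Y)
    (f : X -> Y) :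
  (forall (A : set Y) x, open A -> A x -> exists i, B i x /\ B i `<=` A) ->
  (forall i, borel (f @^-1` (B i))) -> borel_fun f.
Proof.
move=> Bb fB; apply: borel_fun_open => A oA.
have -> : f @^-1` A = [set x | exists i, B i `<=` A /\ B i (f x)].
  apply/seteqP; split=> [x Afx|x [i [BA Bx]]]; last exact: BA.
  by have [i [? ?]] := Bb _ _ oA Afx; exists i.
apply: borel_exists => i; apply: borel_and; [exact: borel_const|exact: fB].
Qed.

Definition box_filter (T : nat -> topologicalType) (x : prod_topology T) :
    set_system (prod_topology T) :=
  [set A | exists n (U : forall i, set (T i)),
    (forall i, open (U i) /\ U i (x i)) /\
    [set y : prod_topology T | forall i, (i < n)%N -> U i (y i)] `<=` A].

Lemma box_filterP (T : nat -> topologicalType) (x : prod_topology T) :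
  Filter (box_filter x).
Proof.
split.
- by exists 0, (fun=> setT); split=> // i; split=> //; exact: openT.
- move=> A B [n [U [oU UA]]] [m [V [oV VB]]].
  exists (maxn n m), (fun i => U i `&` V i); split=> [i|y Hy].
    by have [? ?] := oU i; have [? ?] := oV i; split; [exact: openI|].
  by split; [apply: UA|apply: VB] => i ilt; have [] := Hy i;
    rewrite ?leq_max ?ilt ?orbT.
- move=> A B AB [n [U [oU UA]]]; exists n, U; split=> // y Hy; exact/AB/UA.
Qed.

Lemma prod_topology_box (T : nat -> topologicalType) (A : set (prod_topology T))
    (x : prod_topology T) : open A -> A x -> box_filter x A.
Proof.
move=> oA Ax.
have FF := box_filterP x.
suff : box_filter x --> x by apply; exact: open_nbhs_nbhs.
apply/cvg_sup => i B /=.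
rewrite (@nbhsE (initial_topology (fun f : forall j, T j => f i))) => -[C [[D oD <-] Dx] CB].
apply: filterS CB _.
exists i.+1, (fun j => [set y : T j | forall e : j = i, D (ecast k (T k) e y)]).
split=> [j|y /(_ i (leqnn _) (erefl _))//].
have [e|ne] := pselect (j = i).
  subst j; split=> [|e]; last by rewrite (eq_axiomK e).
  suff -> : [set y | forall e : i = i, D (ecast k (T k) e y)] = D by [].
  apply/seteqP; split=> y /=; first by move=> /(_ (erefl _)).
  by move=> Dy e; rewrite (eq_axiomK e).
rewrite (_ : [set y | _] = setT); first by split=> //; exact: openT.
by apply/seteqP; split=> // y _ e; case: (ne e).
Qed.

Lemma dep_choice (I : Type) (T : I -> Type) (P : forall i, T i -> Prop) :
  (forall i, exists x, P i x) -> exists f : forall i, T i, forall i, P i (f i).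
Proof. by move=> H; exists (fun i => sval (cid (H i))) => i; case: cid. Qed.

Lemma borel_fun_prod (X : topologicalType) (T : nat -> topologicalType)
    (f : X -> prod_topology T) :
  (forall i, countably_based (T i)) ->
  (forall i, borel_fun (fun x => f x i)) -> borel_fun f.
Proof.
move=> cT bf.
have [I HI] := choice cT; have [B HB] := dep_choice HI.
pose J := {i : nat & I i}.
pose box (s : seq J) : set (prod_topology T) :=
  [set y | forall j : J, j \in s -> B (tag j) (tagged j) (y (tag j))].
apply: (@borel_fun_base _ _ (seq J) box) => [A x oA Ax|s].
  have [n [U [oU UA]]] := prod_topology_box oA Ax.
  have /dep_choice[g Hg] i : exists k : I i, B i k (x i) /\ B i k `<=` U i.
    by have [oUi Ui] := oU i; have [_] := HB i; apply.
  exists [seq Tagged I (g i) | i <- iota 0 n]; split.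
    by move=> _ /mapP[i _ ->] /=; have [] := Hg i.
  move=> y yb; apply: UA => i ilt; have [_] := Hg i; apply.
  apply: (yb (Tagged I (g i))); apply/mapP; exists i => //.
  by rewrite mem_iota.
apply: borel_forall => j; apply: borel_imply; first exact: borel_const.
by apply: (bf (tag j)); apply: borel_open; have [] := HB (tag j).
Qed.

Lemma countably_based_prod (T : nat -> topologicalType) :
  (forall i, countably_based (T i)) -> countably_based (prod_topology T).
Proof.
move=> cT.
have [I HI] := choice cT; have [B HB] := dep_choice HI.
pose J := {i : nat & I i}.
pose box (s : seq J) : set (prod_topology T) :=
  [set y | forall j : J, j \in s -> B (tag j) (tagged j) (y (tag j))].
exists (seq J), box; split=> [s|A x oA Ax].
  elim: s => [|j s IHs].
    by rewrite (_ : box _ = setT); [exact: openT|apply/seteqP; split].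
  have -> : box (j :: s) = ((fun y : prod_topology T => y (tag j)) @^-1` B (tag j) (tagged j)) `&` box s.
    apply/seteqP; split=> [y H|y [yj ys] k].
      split; first by apply: H; rewrite inE eqxx.
      by move=> k ks; apply: H; rewrite inE ks orbT.
    by rewrite inE => /predU1P[->//|/ys].
  apply: openI => //.
  have pc : continuous (fun y : prod_topology T => y (tag j)).
    exact: (@proj_continuous nat T (tag j)).
  by move/continuousP: pc; apply; have [] := HB (tag j).
have [n [U [oU UA]]] := prod_topology_box oA Ax.
have /dep_choice[g Hg] i : exists k : I i, B i k (x i) /\ B i k `<=` U i.
  by have [oUi Ui] := oU i; have [_] := HB i; apply.
exists [seq Tagged I (g i) | i <- iota 0 n]; split.
  by move=> _ /mapP[i _ ->] /=; have [] := Hg i.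
move=> y yb; apply: UA => i ilt; have [_] := Hg i; apply.
apply: (yb (Tagged I (g i))); apply/mapP; exists i => //.
by rewrite mem_iota.
Qed.

Lemma rat_itv_base (A : set R) (x : R) : open A -> A x ->
  exists q : rat * rat, (ratr q.1 < x /\ x < ratr q.2)%R /\
    [set y : R | ratr q.1 < y /\ y < ratr q.2]%R `<=` A.
Proof.
move=> oA Ax; have /nbhs_ballP[e /= e0 He] : nbhs x A by exact: open_nbhs_nbhs.
have [|p] := @rat_in_itvoo R (x - e)%R x; first by rewrite ltrBlDr ltrDl.
rewrite in_itv /= => /andP[p1 p2].
have [|q] := @rat_in_itvoo R x (x + e)%R; first by rewrite ltrDl.
rewrite in_itv /= => /andP[q1 q2].
exists (p, q); split=> //= y /= [py yq]; apply: He.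
rewrite /ball /= ltr_distlC; apply/andP; split.
  exact: lt_trans py.
exact: lt_trans yq _.
Qed.

Lemma countably_based_R : countably_based (R : topologicalType).
Proof.
exists (rat * rat)%type, (fun q => [set x : R | ratr q.1 < x /\ x < ratr q.2]%R).
split=> [q|]; last exact: rat_itv_base.
rewrite (_ : [set x | _] = `]ratr q.1, ratr q.2[%classic); first exact: interval_open.
by apply/seteqP; split=> x /=; rewrite in_itv /= => /andP.
Qed.

Lemma countably_based_plus n : countably_based (plus_space n).
Proof.
elim: n => [|n IHn] /=; first exact: countably_based_R.
exact: countably_based_prod.
Qed.

(** * Hereditarily countable sets of reals *)

(* Comparing elements of possibly different ranks lets sets of all ranks live in
   the single type [hset] below, without casts. *)
Fixpoint cmp (k k' : nat) : plus_space k -> plus_space k' -> Prop :=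
  match k, k' return plus_space k -> plus_space k' -> Prop with
  | 0, 0 => fun x y => x = y
  | m.+1, m'.+1 => fun x y => (forall i, exists j, cmp (x i) (y j)) /\
                              (forall j, exists i, cmp (x i) (y j))
  | _, _ => fun _ _ => False
  end.

Lemma cmp_refl k (x : plus_space k) : cmp x x.
Proof. by elim: k x => [|k IHk] x //=; split=> i; exists i. Qed.

Lemma cmp_sym k k' (x : plus_space k) (y : plus_space k') : cmp x y -> cmp y x.
Proof.
elim: k k' x y => [|k IHk] [|k'] x y //= [H1 H2].
split=> [j|i]; [have [i /IHk] := H2 j|have [j /IHk] := H1 i]; by [exists i|exists j].
Qed.

Lemma cmp_trans k k' k'' (x : plus_space k) (y : plus_space k')
  (z : plus_space k'') : cmp x y -> cmp y z -> cmp x z.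
Proof.
elim: k k' k'' x y z => [|k IHk] [|k'] [|k''] x y z //=; first by move=> -> ->.
move=> [H1 H2] [H3 H4]; split=> [i|l].
  have [j ij] := H1 i; have [l jl] := H3 j; exists l; exact: IHk jl.
have [j jl] := H4 l; have [i ij] := H2 j; exists i; exact: IHk jl.
Qed.

Lemma cmp_rank k k' (x : plus_space k) (y : plus_space k') : cmp x y -> k = k'.
Proof.
elim: k k' x y => [|k IHk] [|k'] x y //= [H _].
by have [j /IHk e] := H 0; congr _.+1.
Qed.

Lemma fs_jumpP (X : Type) (E : X -> X -> Prop) : Defs.equivalence_rel E ->
  forall x y : nat -> X, fs_jump E x y <->
    (forall i, exists j, E (x i) (y j)) /\ (forall j, exists i, E (x i) (y j)).
Proof.
move=> [Er [Es Et]] x y.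
have cl a b : E a b -> [set z | E a z] = [set z | E b z].
  move=> ab; apply/seteqP; split=> z /=; first exact/Et/Es.
  exact: Et.
rewrite /fs_jump; split=> [H|[H1 H2]].
  split=> i.
    have : range (fun i => [set z | E (x i) z]) [set z | E (x i) z] by exists i.
    by rewrite H => -[j _ e]; exists j; apply: Es; rewrite -[E _ _]/([set z | E (y j) z] (x i)) e; exact: Er.
  have : range (fun i => [set z | E (y i) z]) [set z | E (y i) z] by exists i.
  by rewrite -H => -[j _ e]; exists j; rewrite -[E _ _]/([set z | E (x j) z] (y i)) e; exact: Er.
apply/seteqP; split=> _ [i _ <-].
  by have [j /cl ->] := H1 i; exists j.
by have [j /cl <-] := H2 i; exists j.
Qed.

Lemma eq_plusE k : Defs.equivalence_rel (@eq_plus k) /\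
  forall x y, eq_plus x y <-> @cmp k k x y.
Proof.
elim: k => [|k [IHe IHk]].
  by split=> //; split=> // ; split=> // x y z /= -> ->.
have H x y : @eq_plus k.+1 x y <-> @cmp k.+1 k.+1 x y.
  apply: iff_trans (fs_jumpP IHe x y) _.
  by split=> -[H1 H2]; split=> i; have [j /IHk ?] := H1 i; have [j' /IHk ?] := H2 i;
    by [exists j|exists j'].
split=> //; split; first by move=> x; apply/H; exact: cmp_refl.
split=> [x y /H xy|x y z /H xy /H yz]; apply/H; first exact: cmp_sym.
exact: cmp_trans yz.
Qed.

Lemma eq_plusP k (x y : plus_space k) : eq_plus x y <-> cmp x y.
Proof. by have [_ ->] := eq_plusE k. Qed.

Lemma borel_coord (X : topologicalType) (T : nat -> topologicalType)
  (u : X -> prod_topology T) i : borel_fun u -> borel_fun (fun x => u x i).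
Proof.
move=> bu; apply: (borel_fun_comp bu (g := fun y : prod_topology T => y i)).
apply: borel_fun_continuous; exact: (@proj_continuous nat T i).
Qed.

Lemma borel_ltr (X : topologicalType) (u : X -> R) (r : R) :
  borel_fun (u : X -> (R : topologicalType)) -> borel [set x | (u x < r)%R].
Proof. by move=> bu; apply: (bu [set y | y < r]%R); apply: borel_open; exact: open_lt. Qed.

Lemma borel_gtr (X : topologicalType) (u : X -> R) (r : R) :
  borel_fun (u : X -> (R : topologicalType)) -> borel [set x | (r < u x)%R].
Proof. by move=> bu; apply: (bu [set y | r < y]%R); apply: borel_open; exact: open_gt. Qed.

Lemma borel_cmp (X : topologicalType) k k' (u : X -> plus_space k)
    (v : X -> plus_space k') :
  borel_fun u -> borel_fun v -> borel [set x | cmp (u x) (v x)].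
Proof.
elim: k k' u v => [|k IHk] [|k'] u v bu bv /=; try exact: borel_const.
  have -> : [set x | u x = v x] = [set x | ~ exists q : rat,
      ((u x < ratr q /\ ratr q < v x) \/ (v x < ratr q /\ ratr q < u x))%R].
    apply/seteqP; split=> [x /= -> [q [][]]|x /= H].
    - by move=> a /(lt_trans a); rewrite ltxx.
    - by move=> a /(lt_trans a); rewrite ltxx.
    case: (ltgtP (u x : R) (v x : R)) => // /rat_in_itvoo[q];
      rewrite in_itv /= => /andP[? ?]; exfalso; apply: H; exists q; [by left|by right].
  apply: borel_not; apply: borel_exists => q.
  apply: borel_or; apply: borel_and.
  - exact: borel_ltr.
  - exact: borel_gtr.
  - exact: borel_ltr.
  - exact: borel_gtr.
have bc i j : borel [set x | cmp (u x i) (v x j)].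
  by apply: IHk; [exact: (@borel_coord _ (fun=> plus_space k))
                 |exact: (@borel_coord _ (fun=> plus_space k'))].
by apply: borel_and; apply: borel_forall => i; exact: borel_exists.
Qed.

Definition hset := {k : nat & plus_space k}.

Definition rk (h : hset) : nat := tag h.

Definition heq (h h' : hset) : Prop := cmp (tagged h) (tagged h').

Definition hmem (h h' : hset) : Prop :=
  match h' with
  | existT k.+1 x => exists i, cmp (tagged h) ((x : nat -> plus_space k) i)
  | _ => False
  end.

(* A set of rank 0 is its own child, so that children can be taken along any path. *)
Definition hchild (h : hset) (i : nat) : hset :=
  match h with
  | existT k.+1 x => existT _ k ((x : nat -> plus_space k) i)
  | existT 0 _ => h
  end.

Definition hbit (h : hset) (r : rat) : bool :=
  match h with
  | existT 0 x => ((x : R) < ratr r)%R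
  | _ => false
  end.

Lemma heq_refl h : heq h h. Proof. exact: cmp_refl. Qed.

Lemma heq_sym h h' : heq h h' -> heq h' h. Proof. exact: cmp_sym. Qed.

Lemma heq_trans h h' h'' : heq h h' -> heq h' h'' -> heq h h''.
Proof. exact: cmp_trans. Qed.

Lemma heq_rk h h' : heq h h' -> rk h = rk h'. Proof. exact: cmp_rank. Qed.

Lemma heq_hbit h h' : heq h h' -> hbit h =1 hbit h'.
Proof. by case: h => [[|k] x]; case: h' => [[|k'] x']; rewrite /heq //= => ->. Qed.

Lemma hbit_heq h h' : rk h = 0 -> rk h' = 0 -> hbit h =1 hbit h' -> heq h h'.
Proof.
case: h => [[|k] x] //; case: h' => [[|k'] y] //= _ _ H; rewrite /heq /=.
by case: (ltgtP (x : R) (y : R)) => // /rat_in_itvoo[q]; rewrite in_itv /= => /andP[a b];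
  have := H q; rewrite /= ?a ?b; have := lt_gtF a; have := lt_gtF b; move=> -> // ->.
Qed.

Lemma hmemP c b : hmem c b <-> (0 < rk b)%N /\ exists i, heq c (hchild b i).
Proof. by case: b => [[|k] x] /=; split=> // -[]. Qed.

Lemma rk_hchild h i : rk (hchild h i) = (rk h).-1.
Proof. by case: h => [[|k] x]. Qed.

Lemma heq_hchild a b : heq a b -> forall i, exists j, heq (hchild a i) (hchild b j).
Proof.
case: a => [[|k] x]; case: b => [[|k'] y] //; rewrite /heq /=.
  by move=> e i; exists 0.
by case.
Qed.

Lemma hmem_heq a a' b b' : heq a a' -> heq b b' -> hmem a b -> hmem a' b'.
Proof.
move=> aa bb /hmemP[b0 [i ai]]; apply/hmemP; split; first by rewrite -(heq_rk bb).
have [j ij] := heq_hchild bb i; exists j.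
exact: heq_trans (heq_trans (heq_sym aa) ai) ij.
Qed.

Lemma hsep b b' : rk b = rk b' -> (0 < rk b)%N -> ~ heq b b' ->
  exists c, ((exists i, c = hchild b i) \/ (exists i, c = hchild b' i)) /\
    ~ (hmem c b <-> hmem c b').
Proof.
case: b => [[|k] x] //; case: b' => [[|k'] y] //; rewrite /heq /= => -[e] _.
subst k' => /not_andP[] /existsNP[i Hi].
  exists (existT _ k (x i)); split; first by left; exists i.
  by move=> [+ _] => /(_ (ex_intro _ i (cmp_refl _)))/Hi.
exists (existT _ k (y i)); split; first by right; exists i.
move=> [_ +] => /(_ (ex_intro _ i (cmp_refl _)))[j yx]; apply: Hi.
by exists j; exact: cmp_sym.
Qed.

Definition borel_hset (X : topologicalType) (F : X -> hset) :=
  exists k (f : X -> plus_space k), borel_fun f /\ forall x, F x = existT _ k (f x).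

Lemma borel_hchild (X : topologicalType) (F : X -> hset) i :
  borel_hset F -> borel_hset (fun x => hchild (F x) i).
Proof.
move=> [[|k] [f [bf FE]]].
  by exists 0, f; split=> // x; rewrite FE.
exists k, (fun x => (f x : nat -> plus_space k) i); split; last by move=> x; rewrite FE.
exact: (borel_coord (T := fun=> plus_space k)).
Qed.

Lemma borel_heq (X : topologicalType) (F G : X -> hset) :
  borel_hset F -> borel_hset G -> borel [set x | heq (F x) (G x)].
Proof.
move=> [k [f [bf FE]]] [k' [g [bg GE]]].
rewrite (_ : [set x | _] = [set x | cmp (f x) (g x)]); first exact: borel_cmp.
by apply/seteqP; split=> x /=; rewrite FE GE.
Qed.

Lemma borel_hmem (X : topologicalType) (F G : X -> hset) :
  borel_hset F -> borel_hset G -> borel [set x | hmem (F x) (G x)].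
Proof.
move=> bF bG; have [k [g [bg GE]]] := bG.
rewrite (_ : [set x | _] = [set x | (0 < k)%N /\ exists i, heq (F x) (hchild (G x) i)]).
  apply: borel_and; first exact: borel_const.
  by apply: borel_exists => i; apply: borel_heq => //; exact: borel_hchild.
by apply/seteqP; split=> x /=; rewrite hmemP GE.
Qed.

Lemma borel_hbit (X : topologicalType) (F : X -> hset) r :
  borel_hset F -> borel [set x | hbit (F x) r].
Proof.
move=> [[|k] [f [bf FE]]].
  rewrite (_ : [set x | _] = [set x | (f x < ratr r :> R)%R]); first exact: borel_ltr.
  by apply/seteqP; split=> x /=; rewrite FE.
rewrite (_ : [set x | _] = set0); first by apply: borel_open; exact: open0.
by apply/seteqP; split=> x //=; rewrite FE.
Qed.

(** * A Borel injection of Cantor space into the reals *)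

Definition ternary (x : nat -> bool) (n : nat) : R :=
  (\sum_(i < n) (x i)%:R * 3 ^- i)%R.

Definition kappa (x : nat -> bool) : R := sup (range (ternary x)).

Lemma ternaryS x n : ternary x n.+1 = (ternary x n + (x n)%:R * 3 ^- n)%R.
Proof. by rewrite /ternary big_ord_recr. Qed.

Lemma ternary_le x n m : (n <= m)%N -> (ternary x n <= ternary x m)%R.
Proof.
move=> /subnK <-; elim: (m - n) => [|k IHk] //.
rewrite addSn ternaryS; apply: le_trans IHk _; rewrite lerDl.
by rewrite mulr_ge0 // invr_ge0 exprn_ge0.
Qed.

Lemma ternary_ub x n m : (ternary x m <= ternary x n + 3 / 2 * 3 ^- n)%R.
Proof.
have [mn|/ltnW/subnK <-] := leqP m n.
  apply: le_trans (ternary_le x mn) _.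
  by rewrite lerDl mulr_ge0 // invr_ge0 exprn_ge0.
have : (ternary x (m - n + n) + 3 / 2 * 3 ^- (m - n + n)
        <= ternary x n + 3 / 2 * 3 ^- n)%R.
  elim: (m - n) => [|k IHk] //; apply: le_trans IHk.
  rewrite addSn ternaryS exprSr invfM.
  have : (0 <= 3 ^- (k + n) :> R)%R by rewrite invr_ge0 exprn_ge0.
  move: (3 ^- (k + n))%R => t t0.
  have : ((x (k + n)%N)%:R * t <= t)%R by case: (x _); rewrite ?mul1r ?mul0r.
  move: (_ * t)%R (ternary x _) => a b ?; lra.
apply: le_trans; by rewrite lerDl mulr_ge0 // invr_ge0 exprn_ge0.
Qed.

Lemma ternary_has_sup x : has_sup (range (ternary x)).
Proof.
split; first by exists (ternary x 0), 0.
by exists (ternary x 0 + 3 / 2 * 3 ^- 0)%R => _ [m _ <-]; exact: ternary_ub.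
Qed.

Lemma ternary_kappa x n : (ternary x n <= kappa x)%R.
Proof. by apply: sup_upper_bound; [exact: ternary_has_sup|exists n]. Qed.

Lemma kappa_ub x n : (kappa x <= ternary x n + 3 / 2 * 3 ^- n)%R.
Proof.
apply: ge_sup; first by exists (ternary x 0), 0.
by move=> _ [m _ <-]; exact: ternary_ub.
Qed.

Lemma kappa_ge0 x : (0 <= kappa x)%R.
Proof. by have := ternary_kappa x 0; rewrite /ternary big_ord0. Qed.

Lemma kappa_inj x y : kappa x = kappa y -> x =1 y.
Proof.
move=> e n; elim/ltn_ind: n => n IHn.
wlog : x y e IHn / ~~ x n /\ y n.
  move=> H; case: (boolP (x n)) (boolP (y n)) => [xn [//|yn]|xn [yn|//]]; last first.
    by have := H x y e IHn (conj xn yn); rewrite yn (negbTE xn).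
  have := H y x (esym e) (fun m mn => esym (IHn m mn)) (conj yn xn).
  by rewrite xn (negbTE yn).
move=> [xn yn]; exfalso.
have tE : ternary x n = ternary y n by apply: eq_bigr => i _; rewrite IHn.
have := kappa_ub x n.+1; have := ternary_kappa y n.+1; rewrite !ternaryS e tE.
rewrite (negbTE xn) yn mul0r mul1r exprSr invfM.
have : (0 < 3 ^- n :> R)%R by rewrite invr_gt0 exprn_gt0.
move: (3 ^- n)%R (ternary y n) => t s ?; lra.
Qed.

Lemma borel_fun_R (X : topologicalType) (f : X -> (R : topologicalType)) :
  (forall q : rat, borel [set x | (ratr q < f x :> R)%R]) -> borel_fun f.
Proof.
move=> fq.
pose B := fun q : rat * rat => [set x : R | ratr q.1 < x /\ x < ratr q.2]%R.
apply: (borel_fun_base (B := B)) rat_itv_base _ => -[p q].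
rewrite (_ : _ @^-1` _ = [set x | (ratr p < f x :> R)%R /\
    exists r : rat, (r < q)%R /\ ~ (ratr r < f x :> R)%R]).
  apply: borel_and => //; apply: borel_exists => r.
  by apply: borel_and; [exact: borel_const|exact: borel_not].
apply/seteqP; split=> x /= [px xq]; split=> //.
  have [r] := rat_in_itvoo xq; rewrite in_itv /= => /andP[xr rq].
  exists r; split; first by move: rq; rewrite ltr_rat.
  by apply/negP; rewrite -leNgt ltW.
have [r [rq /negP]] := xq; rewrite -leNgt => /le_lt_trans; apply.
by rewrite ltr_rat.

Qed.

Lemma borel_ternary (X : topologicalType) (u : X -> nat -> bool) n (P : R -> Prop) :
  (forall n, borel [set x | u x n]) -> borel [set x | P (ternary (u x) n)].
Proof.
move=> bu; elim: n P => [|n IHn] P.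
  rewrite (_ : [set x | _] = [set x | P 0%R]); first exact: borel_const.
  by apply/seteqP; split=> x /=; rewrite /ternary big_ord0.
rewrite (_ : [set x | _] = [set x | (u x n /\ P (ternary (u x) n + 3 ^- n)%R) \/
    (~ u x n /\ P (ternary (u x) n))]).
  apply: borel_or; apply: borel_and => //.
  - exact: (IHn (fun r => P (r + 3 ^- n)%R)).
  - exact: borel_not.
apply/seteqP; split=> x /=; rewrite ternaryS; case: (u x n); rewrite ?mul1r ?mul0r ?addr0.
- by left.
- by right.
- by case=> [[]//|[]].
- by case=> [[]//|[]].
Qed.

Lemma borel_kappa (X : topologicalType) (u : X -> nat -> bool) :
  (forall n, borel [set x | u x n]) -> borel_fun (fun x => kappa (u x) : (R : topologicalType)).
Proof.
move=> bu; apply: borel_fun_R => q.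
rewrite (_ : [set x | _] = [set x | exists n, (ratr q < ternary (u x) n :> R)%R]).
  by apply: borel_exists => n; exact: (borel_ternary n (fun r => (ratr q < r)%R)).
apply/seteqP; split=> x /=; last by move=> [n /lt_le_trans]; apply; exact: ternary_kappa.
move=> qk; apply: contrapT => H; move: qk; apply/negP; rewrite -leNgt.
apply: ge_sup; first by exists (ternary (u x) 0), 0.
by move=> _ [m _ <-]; rewrite leNgt; apply/negP => ?; apply: H; exists m.
Qed.

(** * The Baire property *)

Lemma nowhere_dense_meager (T : topologicalType) (A : set T) : nowhere_dense A -> meager A.
Proof. by move=> nA; exists (fun=> A); split=> // x Ax; exists 0. Qed.

Lemma meagerS (T : topologicalType) (A B : set T) : A `<=` B -> meager B -> meager A.
Proof. by move=> AB [F [Fn BF]]; exists F; split=> //; exact: subset_trans BF. Qed.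

Lemma meager_bigcup (T : topologicalType) (A : nat -> set T) :
  (forall n, meager (A n)) -> meager (\bigcup_n A n).
Proof.
move=> /choice[F HF].
exists (fun m => if @unpickle (nat * nat)%type m is Some p then F p.1 p.2 else set0); split.
  move=> m; case: unpickle => [p|]; first by have [+ _] := HF p.1; apply.
  by rewrite /nowhere_dense closure0 interior0.
move=> x [n _ Anx]; have [_ /(_ x Anx)[k _ Fx]] := HF n.
by exists (pickle (n, k)) => //; rewrite pickleK.
Qed.

Lemma meagerU (T : topologicalType) (A B : set T) :
  meager A -> meager B -> meager (A `|` B).
Proof.
move=> mA mB; apply: (@meagerS _ _ (\bigcup_n (if n is 0 then A else B))).
  by move=> x [?|?]; [exists 0|exists 1].
by apply: meager_bigcup => -[].
Qed.

Definition has_baire_property (T : topologicalType) (A : set T) :=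
  exists O : set T, open O /\ meager ((A `\` O) `|` (O `\` A)).

Lemma borel_baire (T : topologicalType) (A : set T) : borel A -> has_baire_property A.
Proof.
have m0 : meager (@set0 T).
  by apply: nowhere_dense_meager; rewrite /nowhere_dense closure0 interior0.
suff : <<s (@open T) >> `<=` @has_baire_property T by apply.
apply: smallest_sub; last by move=> O oO; exists O; split=> //; rewrite setDv setU0.
split.
- by exists set0; split; [exact: open0|rewrite setDv setU0].
- move=> B [ O [oO mO]]; exists (~` closure O); split.
    by apply: closed_openC; exact: closed_closure.
  have nd : nowhere_dense (closure O `\` O).
    rewrite /nowhere_dense -((closure_id _).1 _).
      apply/seteqP; split=> // x; rewrite /interior nbhsE => -[U [oU Ux] UO].
      have [Ox nOx] := UO x Ux.
      have [z [Oz Uz]] := Ox U (open_nbhs_nbhs (conj oU Ux)).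
      by have [_] := UO z Uz.
    by apply: closedI; [exact: closed_closure|exact: open_closedC].
  apply: meagerS (meagerU mO (nowhere_dense_meager nd)).
  move=> x [[[_ nBx] /contrapT cx]|[ncx nnBx]].
    have [Ox|nOx] := pselect (O x); first by left; right.
    by right.
  left; left; split; first by apply: contrapT => nBx; apply: nnBx.
  by move=> Ox; apply: ncx; exact: subset_closure.
- move=> B /choice[ O HO]; exists (\bigcup_n O n); split.
    by apply: bigcup_open => n _; have [] := HO n.
  apply: meagerS (meager_bigcup (fun n => (HO n).2)).
  move=> x [[[n _ Bx] nO]|[[n _ Ox] nB]]; exists n => //.
    by left; split=> // Ox; apply: nO; exists n.
  by right; split=> // Bx; apply: nB; exists n.
Qed.

Lemma nonmeager_comeager (T : topologicalType) (C : set T) :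
  borel C -> ~ meager C ->
  exists (O : set T) (D : nat -> set T), open O /\ O !=set0 /\
    (forall n, open (D n)) /\
    (forall n U, open U -> U !=set0 -> (U `&` D n) !=set0) /\
    O `&` \bigcap_n D n `<=` C.
Proof.
move=> /borel_baire[ O [oO mO]] nm.
have [F [Fn FO]] : meager (O `\` C) by apply: meagerS mO; right.
exists O, (fun n => ~` closure (F n)); split=> //; split.
  apply/set0P/eqP => O0; apply: nm; apply: meagerS mO.
  by move=> x Cx; left; split=> //; rewrite O0.
split; first by move=> n; apply: closed_openC; exact: closed_closure.
split=> [n U oU [u Uu]|x [Ox Dx]].
  apply: contrapT => H.
  have : interior (closure (F n)) u.
    rewrite /interior nbhsE; exists U => // z Uz.
    by apply: contrapT => Fz; apply: H; exists z.
  by rewrite Fn.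
apply: contrapT => nCx; have [n _ Fx] := FO x (conj Ox nCx).
by apply: (Dx n) => //; exact: subset_closure.
Qed.

(** * The Polish space of layered structures *)

(* A layered structure with levels [L_0, L_1, ...], each indexed by [nat]:
   [y 0 i j] is the [i]-th bit of the real labelling element [j] of [L_0], and
   [y k.+1 i j] says that element [i] of [L_k] belongs to element [j] of
   [L_(k+1)]. *)
Definition lstruct := nat -> nat -> nat -> bool.

Definition agree (n : nat) (x y : lstruct) : Prop :=
  forall k i j, (k < n)%N -> (i < n)%N -> (j < n)%N -> x k i j = y k i j.

Lemma agreexx n x : agree n x x. Proof. by []. Qed.

Lemma agree_sym n x y : agree n x y -> agree n y x.
Proof. by move=> H k i j kn in_ jn; rewrite H. Qed.

Lemma agree_trans n x y z : agree n x y -> agree n y z -> agree n x z.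
Proof. by move=> H1 H2 k i j kn in_ jn; rewrite H1 // H2. Qed.

Lemma agree_le m n x y : (m <= n)%N -> agree n x y -> agree m x y.
Proof. by move=> mn H k i j km im jm; apply: H; exact: leq_trans mn. Qed.

Lemma agree_all x y : (forall n, agree n x y) -> x = y.
Proof.
move=> H; apply/funext => k; apply/funext => i; apply/funext => j.
by apply: (H (k + i + j).+1); lia.
Qed.

Definition cylinder_open (A : set lstruct) :=
  forall x, A x -> exists n, forall y, agree n x y -> A y.

Lemma cylinder_openT : cylinder_open setT.
Proof. by move=> x _; exists 0. Qed.

Lemma cylinder_openI : setI_closed cylinder_open.
Proof.
move=> A B oA oB x [/oA[n An] /oB[m Bm]]; exists (maxn n m) => y xy.
by split; [apply: An|apply: Bm]; apply: agree_le xy; rewrite ?leq_maxl ?leq_maxr.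
Qed.

Lemma cylinder_open_bigcup (I : Type) (f : I -> set lstruct) :
  (forall i, cylinder_open (f i)) -> cylinder_open (\bigcup_i f i).
Proof. by move=> H x [i _ /H[n Hn]]; exists n => y /Hn; exists i. Qed.

HB.instance Definition _ := gen_eqMixin lstruct.
HB.instance Definition _ := gen_choiceMixin lstruct.
HB.instance Definition _ := isOpenTopological.Build lstruct
  cylinder_openT cylinder_openI cylinder_open_bigcup.

Lemma lstruct_openE (A : set lstruct) : open A <-> cylinder_open A.
Proof. by []. Qed.

Lemma open_agree n x : open [set y : lstruct | agree n x y].
Proof. by apply/lstruct_openE => y xy; exists n => z yz; exact: agree_trans yz. Qed.

Definition fin_lstruct (S : seq (nat * nat * nat)) : lstruct :=
  fun k i j => (k, i, j) \in S.

Lemma fin_lstruct_dense n (x : lstruct) : exists S, agree n x (fin_lstruct S).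
Proof.
exists [seq t <- [seq (p, j) | p <- [seq (k, i) | k <- iota 0 n, i <- iota 0 n],
  j <- iota 0 n] | x t.1.1 t.1.2 t.2].
move=> k i j kn in_ jn; rewrite /fin_lstruct mem_filter /=.
case: (x k i j) => //=; symmetry.
apply/allpairsPdep; exists (k, i), j; rewrite mem_iota; split=> //.
by apply/allpairsPdep; exists k, i; rewrite !mem_iota.
Qed.

Lemma separable_lstruct : Defs.separable lstruct.
Proof.
exists (range fin_lstruct); split; first exact: sub_countable (card_image_le _ _) (countableP _).
apply/seteqP; split=> // x _ B; rewrite nbhsE => -[U [oU Ux] UB].
have [n Hn] := oU x Ux; have [S xS] := fin_lstruct_dense n x.
by exists (fin_lstruct S); split; [exists S|exact/UB/Hn].
Qed.

Lemma lstruct_neqP (x y : lstruct) : x <> y -> exists n, `[< ~ agree n x y >].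
Proof.
move=> xy; apply: contrapT => H; apply: xy; apply: agree_all => n.
by apply: contrapT => nxy; apply: H; exists n; apply/asboolP.
Qed.

Definition lstruct_dist (x y : lstruct) : R :=
  match pselect (x = y) with
  | left _ => 0%R
  | right xy => ((ex_minn (lstruct_neqP xy))%:R^-1)%R
  end.

Lemma lstruct_dist_lt n x y :
  (lstruct_dist x y < n.+1%:R^-1)%R <-> agree n.+1 x y.
Proof.
rewrite /lstruct_dist; case: pselect => [->|xy].
  by split=> // _; rewrite invr_gt0 ltr0n.
case: ex_minnP => m /asboolP Hm Hmin.
have m0 : (0 < m)%N by case: m Hm {Hmin} => // -[].
rewrite ltf_pV2 ?posrE ?ltr0n // ltr_nat; split=> [nm|H].
  by apply: contrapT => /asboolP /Hmin; lia.
by rewrite ltnNge; apply/negP => mn; apply: Hm; exact: agree_le H.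
Qed.

Lemma lstruct_dist_val x y : lstruct_dist x y = 0%R /\ x = y \/
  exists n, lstruct_dist x y = (n.+1%:R^-1)%R /\ x <> y.
Proof.
rewrite /lstruct_dist; case: pselect => [->|xy]; [by left|right].
by case: ex_minnP => -[|m] /asboolP Hm _; [case: Hm|exists m].
Qed.

Lemma lstruct_dist_metric : is_metric lstruct_dist.
Proof.
have d0 x y : (0 <= lstruct_dist x y)%R.
  by have [[->]|[n [->]]] := lstruct_dist_val x y.
have le_of x y x' y' x'' y'' : (forall n, agree n.+1 x' y' -> agree n.+1 x'' y'' ->
    agree n.+1 x y) ->
    (lstruct_dist x y <= lstruct_dist x' y' + lstruct_dist x'' y'')%R.
  move=> H; have [[-> _]|[n [e _]]] := lstruct_dist_val x y; first exact: addr_ge0.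
  have : ~ agree n.+1 x y by move=> /lstruct_dist_lt; rewrite e ltxx.
  rewrite e => nA; rewrite leNgt; apply/negP => lt; apply: nA.
  by apply: H; apply/lstruct_dist_lt; apply: le_lt_trans lt; rewrite ?lerDl ?lerDr.
split=> //; split=> [x y|]; last split=> [x y|x y z].
- split=> [e|->]; first by have [[]|[n [e' _]]] := lstruct_dist_val x y;
    [|move: e; rewrite e' => /eqP; rewrite invr_eq0 pnatr_eq0].
  by have [[]|[n [_]]] := lstruct_dist_val y y.
- have dxx w : lstruct_dist w w = 0%R by have [[]|[n [_]]] := lstruct_dist_val w w.
  apply/eqP; rewrite eq_le; apply/andP; split.
    by rewrite -[leRHS]addr0 -(dxx x); apply: le_of => n /agree_sym.
  by rewrite -[leRHS]addr0 -(dxx x); apply: le_of => n /agree_sym.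
- by apply: le_of => n; exact: agree_trans.
Qed.

Lemma archi_inv (e : R) : (0 < e)%R -> exists n : nat, (n.+1%:R^-1 < e)%R.
Proof.
by move=> /ltr_add_invr[n]; rewrite add0r; exists n.
Qed.

Lemma lstruct_dist_compatible : metric_compatible lstruct_dist.
Proof.
move=> A; split=> [oA x Ax|H]; last first.
  apply/lstruct_openE => x /H[e [e0 He]].
  have [n ne] := archi_inv e0; exists n.+1 => y /lstruct_dist_lt xy.
  by apply: He; exact: lt_trans ne.
have [n Hn] := oA x Ax.
exists (n.+1%:R^-1)%R; split; first by rewrite invr_gt0 ltr0n.
by move=> y /lstruct_dist_lt/(agree_le (leqnSn n))/Hn.
Qed.

Lemma lstruct_dist_complete : metric_complete lstruct_dist.
Proof.
move=> u Cu.
have /choice[N HN] n : exists N, forall m, (N <= m)%N -> agree n.+1 (u N) (u m).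
  have [|N HN] := Cu (n.+1%:R^-1)%R; first by rewrite invr_gt0 ltr0n.
  by exists N => m Nm; apply/lstruct_dist_lt; exact: HN.
pose l : lstruct := fun k i j => u (N (k + i + j)) k i j.
have Hl n m : (N n <= m)%N -> agree n.+1 (u m) l.
  move=> nm k i j kn in_ jn; rewrite /l.
  transitivity (u (maxn m (N (k + i + j))) k i j).
    rewrite -(HN n m nm) //; apply: (HN n) => //.
    exact: leq_trans (leq_maxl _ _).
  by symmetry; apply: (HN (k + i + j)); rewrite ?leq_maxr //; lia.
exists l => e e0; have [n ne] := archi_inv e0; exists (N n) => m Nm.
by apply: lt_trans ne; apply/lstruct_dist_lt; exact: Hl.
Qed.

Lemma polish_lstruct : polish lstruct.
Proof.
split; first exact: separable_lstruct.
exists lstruct_dist; split; first exact: lstruct_dist_metric.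
split; [exact: lstruct_dist_compatible|exact: lstruct_dist_complete].
Qed.

Lemma borel_fun_lstruct (X : topologicalType) (f : X -> lstruct) :
  (forall k i j, borel [set x | f x k i j]) -> borel_fun f.
Proof.
move=> bf.
pose B := fun p : nat * seq (nat * nat * nat) => [set y | agree p.1 (fin_lstruct p.2) y].
apply: (borel_fun_base (B := B)) => [A x oA Ax|[n S]].
  have [n Hn] := oA x Ax; have [S xS] := fin_lstruct_dense n x.
  exists (n, S); split; first exact: agree_sym.
  by move=> y Sy; apply: Hn; exact: agree_trans Sy.
apply: borel_forall => k; apply: borel_forall => i; apply: borel_forall => j.
do 3 (apply: borel_imply; first exact: borel_const).
case: (fin_lstruct S k i j).
  rewrite (_ : [set x | _] = [set x | f x k i j]); first exact: bf.
  by apply/seteqP; split=> x /=; [move=> <-|move=> ->].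
rewrite (_ : [set x | _] = [set x | ~ f x k i j]); first exact: borel_not.
by apply/seteqP; split=> x /=; [move=> <-|move=> /negP; case: (f x k i j)].
Qed.

Lemma borel_fun_coord3 k i j : borel [set y : lstruct | y k i j].
Proof.
apply: borel_open; apply/lstruct_openE => y yk; exists (k + i + j).+1 => z yz.
by rewrite /= -(yz k i j) //; lia.
Qed.

(** * Mutually generic labels *)

Definition dense_cylinders (D : set lstruct) :=
  forall (x : lstruct) n, exists n' x', (n <= n')%N /\ agree n x x' /\
    forall y, agree n' x' y -> D y.

Lemma open_dense_cylinders (D : set lstruct) : open D ->
  (forall U, open U -> U !=set0 -> (U `&` D) !=set0) -> dense_cylinders D.
Proof.
move=> oD dD x n.
have [y [xy /oD[m Hm]]] := dD _ (@open_agree n x) (ex_intro _ x (@agreexx n x)).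
exists (maxn n m), y; rewrite leq_maxl; split=> //; split=> // z yz; apply: Hm.
by apply: agree_le yz; rewrite leq_maxr.
Qed.

Section GenericLabels.
Variables (str : nat -> seq bool).

Definition lbl (g : nat -> seq bool -> bool) (q : nat) (a : nat -> bool) (i : nat) : bool :=
  if (i < size (str q))%N then nth false (str q) i else g q (mkseq a i).

Definition meets (D : set lstruct) n S (lab : nat -> nat -> bool) B :=
  exists n' x', (n <= n' <= B)%N /\
    (forall i j, (i < n')%N -> (j < n)%N -> x' 0 i j = lab j i) /\
    (forall k i j, (0 < k < n)%N -> (i < n)%N -> (j < n)%N ->
      x' k i j = fin_lstruct S k i j) /\
    forall y, agree n' x' y -> D y.

Lemma meets_mono D n S lab lab' B B' : (B <= B')%N ->
  (forall i j, (i < B)%N -> (j < n)%N -> lab j i = lab' j i) ->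
  meets D n S lab B -> meets D n S lab' B'.
Proof.
move=> BB e [n' [x' [/andP[nn nB] [H1 [H2 H3]]]]]; exists n', x'.
split; first by rewrite nn (leq_trans nB).
split=> // i j ilt jlt; rewrite H1 // e //; exact: leq_trans nB.
Qed.

Definition split_at l n (qs : nat -> nat) (a : nat -> nat -> bool) :=
  forall j j', (j < j')%N -> (j' < n)%N ->
    qs j <> qs j' \/ mkseq (a j) l <> mkseq (a j') l.

Lemma take_mkseq (T : Type) (a : nat -> T) l m : (l <= m)%N -> take l (mkseq a m) = mkseq a l.
Proof. by move=> lm; rewrite /mkseq -map_take take_iota (minn_idPl lm). Qed.

Section Step.
Variables (D : set lstruct) (n l : nat) (S : seq (nat * nat * nat)) (qs : nat -> nat).
Variables (L : nat) (g : nat -> seq bool -> bool).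
Hypotheses (dD : dense_cylinders D) (lL : (l <= L)%N) (nL : (n <= L)%N)
  (strL : forall j, (j < n)%N -> (size (str (qs j)) <= L)%N).

(* Above length [L] the extended function only looks at the first [L] bits, so it
   can be adjusted for one tuple of strings of length [L] at a time. *)
Definition extend (w : nat -> seq bool -> nat -> bool) q s :=
  if (size s < L)%N then g q s else w q (take L s) (size s).

Definition step_label (w : nat -> seq bool -> nat -> bool) q (t : seq bool) i :=
  if (i < size (str q))%N then nth false (str q) i
  else if (i < L)%N then g q (take i t) else w q t i.

Lemma lbl_extend w q a i : lbl (extend w) q a i = step_label w q (mkseq a L) i.
Proof.
rewrite /lbl /step_label /extend; case: ifP => // _; rewrite size_mkseq.
by case: ltnP => Li; rewrite take_mkseq // ltnW.
Qed.

Lemma meets_tuple (t : seq (seq bool)) L1 w : (L <= L1)%N ->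
  exists L2 w', (L1 <= L2)%N /\ (forall q s i, (i < L1)%N -> w' q s i = w q s i) /\
    forall a, split_at l n qs a -> (forall j, (j < n)%N -> nth [::] t j = mkseq (a j) L) ->
      meets D n S (fun j => lbl (extend w') (qs j) (a j)) L2.
Proof.
move=> LL1.
pose zs := mkseq (fun j => (qs j, nth [::] t j)) n.
have [uz|nuz] := boolP (uniq zs); last first.
  exists L1, w; split=> //; split=> // a sa ta; case/negP: nuz.
  apply/(uniqP (0, [::])) => j j'; rewrite !inE size_mkseq => jn jn'.
  rewrite !nth_mkseq // => -[eq et].
  have ne i i' : (i < i')%N -> (i' < n)%N -> qs i = qs i' ->
      nth [::] t i = nth [::] t i' -> False.
    move=> ii i'n e; rewrite !ta //; last exact: ltn_trans i'n.
    move=> e2; have [//|] := sa i i' ii i'n.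
    by rewrite -!(take_mkseq _ lL) e2.
  by case: (ltngtP j j') => // jj; exfalso; [apply: (ne j j')|apply: (ne j' j)].
pose y0 : lstruct := fun k i j =>
  if k == 0 then step_label w (qs j) (nth [::] t j) i else fin_lstruct S k i j.
have [L2 [x' [L12 [yx xD]]]] := dD y0 L1.
exists L2, (fun q s i => if (i < L1)%N then w q s i else x' 0 i (index (q, s) zs)).
split=> //; split=> [q s i ->//|a sa ta].
exists L2, x'; split; first by rewrite leqnn andbT (leq_trans nL) // (leq_trans LL1).
split=> [i j iL2 jn|]; last split=> // k i j /andP[k0 kn] in_ jn.
  rewrite lbl_extend -ta // /step_label.
  have [iL1|L1i] := ltnP i L1.
    have jL1 : (j < L1)%N by apply: leq_trans LL1; exact: leq_trans nL.
    by rewrite -yx // ?(leq_ltn_trans _ jL1) // /y0 /= /step_label.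
  have Li : (L <= i)%N by exact: leq_trans L1i.
  rewrite ltnNge (leq_trans (strL jn) Li) /= ltnNge Li /=.
  have zj : (qs j, nth [::] t j) = nth (0, [::]) zs j by rewrite nth_mkseq.
  by rewrite zj index_uniq // size_mkseq.
have nL1 := leq_trans nL LL1.
rewrite -yx ?(leq_trans _ nL1) // /y0.
by case: k k0 kn.
Qed.

Lemma meets_tuples (ts : seq (seq (seq bool))) L1 w : (L <= L1)%N ->
  exists L2 w', (L1 <= L2)%N /\ (forall q s i, (i < L1)%N -> w' q s i = w q s i) /\
    forall t, t \in ts -> forall a, split_at l n qs a ->
      (forall j, (j < n)%N -> nth [::] t j = mkseq (a j) L) ->
      meets D n S (fun j => lbl (extend w') (qs j) (a j)) L2.
Proof.
elim: ts L1 w => [|t ts IHts] L1 w LL1; first by exists L1, w.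
have [L2 [w2 [L12 [e2 H2]]]] := meets_tuple t w LL1.
have [L3 [w3 [L23 [e3 H3]]]] := IHts L2 w2 (leq_trans LL1 L12).
exists L3, w3; split; first exact: leq_trans L23.
split=> [q s i iL|u]; first by rewrite e3 ?e2 // (leq_trans iL).
rewrite inE => /predU1P[->|uts] a sa ta; last exact: H3 ta.
apply: meets_mono L23 _ (H2 a sa ta) => i j iL jn.
by rewrite !lbl_extend /step_label e3.
Qed.

Lemma meets_all : exists L' g', (L < L')%N /\
  (forall q s, (size s < L)%N -> g' q s = g q s) /\
  forall g'', (forall q s, (size s < L')%N -> g'' q s = g' q s) ->
    forall a, split_at l n qs a -> meets D n S (fun j => lbl g'' (qs j) (a j)) L'.
Proof.
pose ts := [seq [seq tval u | u <- tval t] | t <- enum {: n.-tuple (L.-tuple bool)}].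
have [L2 [w [LL2 [_ H]]]] := meets_tuples ts (fun _ _ _ => false) (leqnn L).
exists L2.+1, (extend w); split=> //.
split=> [q s|g'' eg a sa]; first by rewrite /extend => ->.
pose t : n.-tuple (L.-tuple bool) := mktuple (fun j => mktuple (fun i => a j i)).
have tE j : (j < n)%N -> nth [::] [seq tval u | u <- tval t] j = mkseq (a j) L.
  move=> jn; rewrite (nth_map (mktuple (fun=> false))) ?size_tuple //.
  apply: (@eq_from_nth _ false); first by rewrite size_tuple size_mkseq.
  move=> i; rewrite size_tuple => iL; rewrite nth_mkseq //.
  rewrite -[nth _ _ j](tnth_nth _ t (Ordinal jn)) tnth_mktuple.
  by rewrite -[LHS](tnth_nth _ _ (Ordinal iL)) tnth_mktuple.
apply: meets_mono (leqnSn L2) _ (H _ _ a sa tE).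
  move=> i j iL jn; rewrite /lbl; case: ifP => // _.
  by rewrite eg // size_mkseq ltnS ltnW.
by apply: map_f; rewrite mem_enum.
Qed.

End Step.

(* A form of Mycielski's theorem: a single function [g] makes the labels of any
   finitely many distinct pairs [(qs j, a j)] jointly generic for all [D m]. *)
Lemma generic_labels (D : nat -> set lstruct) : (forall m, dense_cylinders (D m)) ->
  exists g, forall m n x (qs : nat -> nat) (a : nat -> nat -> bool),
    (forall j j', (j < j')%N -> (j' < n)%N -> qs j <> qs j' \/ ~ a j =1 a j') ->
    exists n' x', (n <= n')%N /\
      (forall i j, (i < n')%N -> (j < n)%N -> x' 0 i j = lbl g (qs j) (a j) i) /\
      (forall k i j, (0 < k < n)%N -> (i < n)%N -> (j < n)%N -> x' k i j = x k i j) /\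
      forall y, agree n' x' y -> D m y.
Proof.
move=> dD.
pose cond := (nat * (nat -> seq bool -> bool))%type.
pose task := (nat * nat * nat * seq (nat * nat * nat) * seq nat)%type.
pose good (T : task) (c c' : cond) := let: (m, n, l, F, Q) := T in
  (c.1 < c'.1)%N /\ (forall q s, (size s < c.1)%N -> c'.2 q s = c.2 q s) /\
  forall g'', (forall q s, (size s < c'.1)%N -> g'' q s = c'.2 q s) ->
    forall a, split_at l n (nth 0 Q) a ->
      meets (D m) n F (fun j => lbl g'' (nth 0 Q j) (a j)) c'.1.
have /choice[step Hstep] (Tc : task * cond) : exists c', good Tc.1 Tc.2 c'.
  case: Tc => -[[[[m n] l] S] Q] [L g].
  pose M := \max_(j < n) size (str (nth 0 Q j)).
  have [||||L' [g' [LL [eg Hg]]]] := @meets_all (D m) n l S (nth 0 Q)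
      (maxn L (maxn l (maxn n M))) g.
  - exact: dD.
  - lia.
  - lia.
  - move=> j jn; have : (size (str (nth 0 Q j)) <= M)%N.
      exact: (@leq_bigmax _ (fun j : 'I_n => size (str (nth 0 Q j))) (Ordinal jn)).
    by lia.
  exists (L', g'); split=> /=; first by lia.
  by split=> // q s sL; rewrite eg //; lia.
pose c := fix c t : cond := if t is t'.+1 then
  (if @unpickle task t' is Some T then step (T, c t') else ((c t').1.+1, (c t').2))
  else (0, fun _ _ => false).
have cE t : c t.+1 = if @unpickle task t is Some T then step (T, c t)
  else ((c t).1.+1, (c t).2) by [].
have cS t : ((c t).1 < (c t.+1).1)%N /\
    (forall q s, (size s < (c t).1)%N -> (c t.+1).2 q s = (c t).2 q s).
  rewrite cE; case: unpickle => [[[[[m n] l] S] Q]|] //=.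
  by have [? []] := Hstep (m, n, l, S, Q, c t).
have cT t t' : (t <= t')%N -> ((c t).1 <= (c t').1)%N /\
    (forall q s, (size s < (c t).1)%N -> (c t').2 q s = (c t).2 q s).
  move=> /subnK <-; elim: (t' - t) => [|d [IH1 IH2]] //.
  have [H1 H2] := cS (d + t); split; first by rewrite addSn; lia.
  by move=> q s sL; rewrite addSn H2 ?IH2 //; lia.
have cL t : (t <= (c t).1)%N.
  by elim: t => // t; have [] := cS t; lia.
pose g q s := (c (size s).+1).2 q s.
have gE t q s : (size s < (c t).1)%N -> g q s = (c t).2 q s.
  move=> sL; rewrite /g.
  have [st|/ltnW ts] := leqP (size s).+1 t.
    by have [_ ->] := cT _ _ st.
  by have [_ ->] := cT _ _ ts.
exists g => m n x qs a dist.
have /choice[b Hb] (p : nat * nat) : exists l, (p.1 < p.2)%N -> (p.2 < n)%N ->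
    qs p.1 <> qs p.2 \/ mkseq (a p.1) l <> mkseq (a p.2) l.
  have [p12|] := boolP (p.1 < p.2)%N; last by exists 0.
  have [pn|] := boolP (p.2 < n)%N; last by exists 0.
  have [|/existsNP[i Hi]] := dist _ _ p12 pn; first by exists 0; left.
  exists i.+1 => _ _; right => e; apply: Hi.
  by rewrite -(nth_mkseq false (a p.1) (ltnSn i)) e nth_mkseq.
pose l := \max_(j < n) \max_(j' < n) b (j : nat, j' : nat).
have [S xS] := fin_lstruct_dense n x.
pose T : task := (m, n, l, S, mkseq qs n).
have sa : split_at l n (nth 0 (mkseq qs n)) a.
  move=> j j' jj j'n; have jn := ltn_trans jj j'n.
  rewrite !nth_mkseq //; have [|ne] := Hb (j, j') jj j'n; [by left|right=> e].
  have bl : (b (j, j') <= l)%N.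
    apply: leq_trans (@leq_bigmax _ (fun j : 'I_n => \max_(j' < n) b (j : nat, j' : nat)) (Ordinal jn)).
    exact: (@leq_bigmax _ (fun j' : 'I_n => b (j, j' : nat)) (Ordinal j'n)).
  by apply: ne; rewrite -(take_mkseq (a j) bl) -(take_mkseq (a j') bl) e.
have [_ [_ /(_ g)/(_ _ a sa)]] : good T (c (pickle T)) (c (pickle T).+1).
  by rewrite cE pickleK; exact: (Hstep (T, c (pickle T))).
case=> [q s sL|n' [x' [/andP[nn _] [H1 [H2 H3]]]]]; first exact: gE.
exists n', x'; split=> //; split=> [i j ilt jlt|]; first by rewrite H1 // nth_mkseq.
split=> // k i j kn ilt jlt; rewrite H2 // xS //.
by have /andP[] := kn.
Qed.

End GenericLabels.

(** * The random structure built from a set *)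

Definition hset0 : hset := existT _ 0 (0%R : R).

HB.instance Definition _ := gen_eqMixin hset.

Definition cmpmx := seq (seq (bool * bool)).

Definition cmp_matrix (us vs : seq hset) : cmpmx :=
  mkseq (fun i => mkseq (fun j => (`[< heq (nth hset0 us i) (nth hset0 vs j) >],
                                  `[< hmem (nth hset0 us i) (nth hset0 vs j) >]))
    (size vs)) (size us).

Definition seq_heq (us vs : seq hset) : Prop :=
  size us = size vs /\ forall i, heq (nth hset0 us i) (nth hset0 vs i).

Lemma seq_heq_refl us : seq_heq us us.
Proof. by split=> // i; exact: heq_refl. Qed.

Lemma seq_heq_sym us vs : seq_heq us vs -> seq_heq vs us.
Proof. by move=> [e H]; split=> // i; exact/heq_sym/H. Qed.

Lemma seq_heq_trans us vs ws : seq_heq us vs -> seq_heq vs ws -> seq_heq us ws.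
Proof.
move=> [e H] [e' H']; split; first by rewrite e.
move=> i; exact: heq_trans (H i) (H' i).
Qed.

Lemma asbool_inj (P Q : Prop) : `[< P >] = `[< Q >] -> (P <-> Q).
Proof. by move=> e; split=> /asboolP H; apply/asboolP; [rewrite -e|rewrite e]. Qed.

Lemma heqE a a' b b' : heq a a' -> heq b b' -> `[< heq a b >] = `[< heq a' b' >].
Proof.
move=> aa bb; apply/asbool_equiv_eq; split=> H.
  exact: heq_trans (heq_trans (heq_sym aa) H) bb.
exact: heq_trans (heq_trans aa H) (heq_sym bb).
Qed.

Lemma hmemE a a' b b' : heq a a' -> heq b b' -> `[< hmem a b >] = `[< hmem a' b' >].
Proof.
move=> aa bb; apply/asbool_equiv_eq; split; apply: hmem_heq => //; exact: heq_sym.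
Qed.

Lemma cmp_matrix_heq us us' vs vs' : seq_heq us us' -> seq_heq vs vs' ->
  cmp_matrix us vs = cmp_matrix us' vs'.
Proof.
move=> [eu Hu] [ev Hv]; rewrite /cmp_matrix eu ev; apply: eq_mkseq => i.
by apply: eq_mkseq => j; rewrite (heqE (Hu i) (Hv j)) (hmemE (Hu i) (Hv j)).
Qed.

Lemma cmp_matrix_nth us vs i j : (i < size us)%N -> (j < size vs)%N ->
  nth (false, false) (nth [::] (cmp_matrix us vs) i) j =
  (`[< heq (nth hset0 us i) (nth hset0 vs j) >], `[< hmem (nth hset0 us i) (nth hset0 vs j) >]).
Proof. by move=> iu jv; rewrite nth_mkseq // nth_mkseq. Qed.

(* A natural number codes the data of an element that do not depend on the coded
   set: a prefix of its real label, marks on its entries, and two lists that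
   decide membership between it and the elements with smaller code one level up
   and one level down. The last component makes such codes arbitrarily large. *)
Definition payload :=
  (seq bool * seq bool * seq (nat * cmpmx) * seq (nat * cmpmx) * nat)%type.

Definition pay (q : nat) : payload :=
  if @unpickle payload q is Some p then p else ([::], [::], [::], [::], 0).

Definition str q : seq bool := let: (s, _, _, _, _) := pay q in s.
Definition marks q : seq bool := let: (_, m, _, _, _) := pay q in m.
Definition up q := let: (_, _, u, _, _) := pay q in u.
Definition down q := let: (_, _, _, d, _) := pay q in d.

Lemma injective_unbounded (f : nat -> nat) B : injective f -> exists n, (B < f n)%N.
Proof.
move=> fi; apply: contrapT => H.
have fB n : (f n < B.+1)%N by rewrite ltnS leqNgt; apply/negP => ?; apply: H; exists n.
have : injective (fun n : 'I_B.+2 => Ordinal (fB n)).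
  by move=> x y [/fi] /val_inj.
by move=> /leq_card; rewrite !card_ord ltnn.
Qed.

Lemma payload_exists s m u d B : exists q,
  [/\ (B < q)%N, str q = s, marks q = m, up q = u & down q = d].
Proof.
have [|n Hn] := @injective_unbounded (fun n => pickle ((s, m, u, d, n) : payload)) B.
  by move=> n n' /(pcan_inj pickleK)[].
exists (pickle ((s, m, u, d, n) : payload)).
by split=> //; rewrite /str /marks /up /down /pay pickleK.
Qed.

Definition elt := (seq hset * nat)%type.

Definition eeq (u v : elt) : Prop := u.2 = v.2 /\ seq_heq u.1 v.1.

Lemma eeq_refl u : eeq u u. Proof. by split=> //; exact: seq_heq_refl. Qed.

Lemma eeq_sym u v : eeq u v -> eeq v u.
Proof. by move=> [? ?]; split=> //; exact: seq_heq_sym. Qed.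

Lemma eeq_trans u v w : eeq u v -> eeq v w -> eeq u w.
Proof. by move=> [e H] [e' H']; split; [rewrite e|exact: seq_heq_trans H']. Qed.

(* The element with the larger code decides; since it only sees the comparison
   matrix of the entries, membership is invariant under [eeq]. *)
Definition emem (u v : elt) : bool :=
  if (v.2 < u.2)%N then (v.2, cmp_matrix u.1 v.1) \in up u.2
  else (u.2, cmp_matrix u.1 v.1) \in down v.2.

Lemma emem_eeq u u' v v' : eeq u u' -> eeq v v' -> emem u v = emem u' v'.
Proof.
by move=> [e H] [e' H']; rewrite /emem e e' (cmp_matrix_heq H H').
Qed.

Definition ebits (bs : seq hset) (i : nat) : bool :=
  if @unpickle (nat * rat)%type i is Some jr then hbit (nth hset0 bs jr.1) jr.2 else false.

Lemma ebits_heq us vs : seq_heq us vs -> ebits us =1 ebits vs.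
Proof.
by move=> [_ H] i; rewrite /ebits; case: unpickle => // jr; exact: heq_hbit.
Qed.

Lemma ebits_inj us vs : size us = size vs -> (forall i, rk (nth hset0 us i) = 0) ->
  (forall i, rk (nth hset0 vs i) = 0) -> ebits us =1 ebits vs -> seq_heq us vs.
Proof.
move=> e u0 v0 H; split=> // j; apply: hbit_heq => // r.
by have := H (pickle ((j, r) : nat * rat)); rewrite /ebits pickleK.
Qed.

Section RootSystem.
Variables (Z : Type) (rho : nat -> nat) (root : nat -> Z -> hset).
Hypothesis root_rk : forall m z, rk (root m z) = rho m.

Definition ecode := (nat * seq nat)%type.
(* [entry z (m, s)] is the hereditary member of [root m z] reached along [s]. *)
Definition entry (z : Z) (p : ecode) : hset := foldl hchild (root p.1 z) p.2.
Definition erank (p : ecode) : nat := rho p.1 - size p.2.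

Lemma rk_entry z p : rk (entry z p) = erank p.
Proof.
rewrite /entry /erank; elim/last_ind: p.2 => [|s i IHs]; first by rewrite subn0 root_rk.
by rewrite foldl_rcons rk_hchild IHs size_rcons subnS.
Qed.

Lemma entry_rcons z m s i : entry z (m, rcons s i) = hchild (entry z (m, s)) i.
Proof. by rewrite /entry /= foldl_rcons. Qed.

Lemma hchild_entry z p i : exists p', hchild (entry z p) i = entry z p'.
Proof. by case: p => m s; exists (m, rcons s i); rewrite entry_rcons. Qed.

Definition code := (seq ecode * nat)%type.

Definition elt_of (z : Z) (u : code) : elt := ([seq entry z p | p <- u.1], u.2).

Definition marks_ok (u : code) : bool :=
  (size u.1 == size (marks u.2)) &&
  all (fun x => x.2 ==> nilp x.1.2) (zip u.1 (marks u.2)).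

Definition valid (k : nat) (u : code) : bool :=
  all (fun p => erank p <= k)%N u.1 && marks_ok u.

Lemma size_elt_of z u : size (elt_of z u).1 = size u.1.
Proof. by rewrite size_map. Qed.

(* Elements of level at most [k.+1] that the entries of [z] of rank at most [k]
   can tell apart; they need not come from [z]. *)
Definition supported (z : Z) (k : nat) (v : elt) : Prop :=
  size v.1 = size (marks v.2) /\ forall j, (j < size v.1)%N ->
    ((rk (nth hset0 v.1 j) <= k)%N /\ exists p, heq (nth hset0 v.1 j) (entry z p)) \/
    (rk (nth hset0 v.1 j) = k.+1 /\
      forall i, exists p, heq (hchild (nth hset0 v.1 j) i) (entry z p)).

Lemma nth_elt_of z u j : (j < size u.1)%N ->
  nth hset0 (elt_of z u).1 j = entry z (nth (0, [::]) u.1 j).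
Proof. by move=> ju; rewrite (nth_map (0, [::])). Qed.

Lemma valid_supported z k u : valid k.+1 u -> supported z k (elt_of z u).
Proof.
move=> /andP[/allP Hr /andP[/eqP e _]]; split; first by rewrite size_map.
move=> j; rewrite size_elt_of => ju; rewrite nth_elt_of // rk_entry.
have := Hr _ (mem_nth (0, [::]) ju); set p := nth _ _ _.
rewrite leq_eqVlt => /predU1P[->|pk]; [right|left].
  by split=> // i; have [p' ->] := hchild_entry z p i; exists p'; exact: heq_refl.
by split=> //; exists p; exact: heq_refl.
Qed.

Lemma row_separation z k v v' : supported z k v -> supported z k v' ->
  v.2 = v'.2 -> ~ eeq v v' ->
  exists p, (erank p <= k)%N /\ forall us, (exists i, (i < size us)%N /\ nth hset0 us i = entry z p) ->
    cmp_matrix us v.1 <> cmp_matrix us v'.1.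
Proof.
move=> [sv Sv] [sv' Sv'] e ne.
have se : size v.1 = size v'.1 by rewrite sv sv' e.
have [j nj] : exists j, ~ heq (nth hset0 v.1 j) (nth hset0 v'.1 j).
  by apply/existsNP => H; apply: ne.
have jv : (j < size v.1)%N.
  rewrite ltnNge; apply/negP => vj; apply: nj.
  by rewrite !nth_default -?se //; exact: heq_refl.
have jv' : (j < size v'.1)%N by rewrite -se.
suff [p [pk Hp]] : exists p, (erank p <= k)%N /\
    ~ ((heq (entry z p) (nth hset0 v.1 j) <-> heq (entry z p) (nth hset0 v'.1 j)) /\
       (hmem (entry z p) (nth hset0 v.1 j) <-> hmem (entry z p) (nth hset0 v'.1 j))).
  exists p; split=> // us [i [iu ui]] eM; apply: Hp.
  have := cmp_matrix_nth iu jv; rewrite eM cmp_matrix_nth // ui.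
  case=> E1 E2; have H1 := asbool_inj E1; have H2 := asbool_inj E2. tauto.
move: nj (Sv j jv) (Sv' j jv').
move: (nth hset0 v.1 j) (nth hset0 v'.1 j) => b b' nj [[bk [p bp]]|[bk Hb]].
  move=> _; exists p; split; first by rewrite -(rk_entry z) -(heq_rk bp).
  move=> [[H _] _]; apply: nj; apply: (heq_trans bp); apply: H; exact: heq_sym bp.
move=> [[bk' [p bp]]|[bk' Hb']].
  exists p; split; first by rewrite -(rk_entry z) -(heq_rk bp).
  move=> [[_ H] _]; apply: nj; apply: heq_sym; apply: (heq_trans bp); apply: H.
  exact: heq_sym bp.
have [|||c [Hc nc]] := @hsep b b'; [by rewrite bk bk'|by rewrite bk|by []|].
have [p cp] : exists p, heq c (entry z p) by case: Hc => -[i ->].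
have rc : rk c = k by case: Hc => -[i ->]; rewrite rk_hchild ?bk ?bk'.
exists p; split; first by rewrite -(rk_entry z) -(heq_rk cp) rc.
move=> [_ [H1 H2]]; apply: nc.
split=> [/(hmem_heq cp (heq_refl _))/H1|/(hmem_heq cp (heq_refl _))/H2];
  exact: hmem_heq (heq_sym cp) (heq_refl _).
Qed.

Lemma column_separation z u u' vs : size u.1 = size u'.1 -> u.2 = u'.2 ->
  ~ eeq (elt_of z u) (elt_of z u') ->
  {subset u.1 <= vs} ->
  cmp_matrix (elt_of z u).1 [seq entry z p | p <- vs] <>
  cmp_matrix (elt_of z u').1 [seq entry z p | p <- vs].
Proof.
move=> su e ne uv eM.
have [j nj] : exists j, ~ heq (nth hset0 (elt_of z u).1 j) (nth hset0 (elt_of z u').1 j).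
  by apply/existsNP => H; apply: ne; split=> //; split=> //; rewrite !size_elt_of.
have ju : (j < size u.1)%N.
  rewrite ltnNge; apply/negP => uj; apply: nj.
  by rewrite !nth_default ?size_elt_of -?su //; exact: heq_refl.
move: nj; rewrite !nth_elt_of -?su //; apply.
set p := nth _ u.1 j; have pv : p \in vs by apply/uv/mem_nth.
have pi : (index p vs < size [seq entry z p | p <- vs])%N by rewrite size_map index_mem.
have ju1 : (j < size (elt_of z u).1)%N by rewrite size_elt_of.
have ju2 : (j < size (elt_of z u').1)%N by rewrite size_elt_of -su.
have := cmp_matrix_nth ju1 pi; rewrite eM cmp_matrix_nth // => -[+ _].
rewrite !nth_elt_of -?su // (nth_map (0, [::])) ?index_mem // nth_index // -/p.
by move=> E1; apply: heq_sym; apply: (asbool_inj E1).2; exact: heq_refl.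
Qed.

(* The entries of the new element are chosen to separate all the given elements, so
   that finite lists of comparison matrices can prescribe any pattern on them. *)
Lemma one_point_extension z k (P : seq (code * bool)) (Q : seq (elt * bool)) s B :
  (forall x, x \in P -> all (fun p => erank p <= k)%N x.1.1 /\ marks_ok x.1) ->
  (forall x y, x \in P -> y \in P -> eeq (elt_of z x.1) (elt_of z y.1) -> x.2 = y.2) ->
  (forall x, x \in Q -> supported z k x.1) ->
  (forall x y, x \in Q -> y \in Q -> eeq x.1 y.1 -> x.2 = y.2) ->
  exists w, [/\ valid k w, str w.2 = s, (B < w.2)%N,
    forall x, x \in P -> emem (elt_of z x.1) (elt_of z w) = x.2 &
    forall x, x \in Q -> emem (elt_of z w) x.1 = x.2].
Proof.
move=> HP HPc HQ HQc.
have /choice[sep Hsep] (x : elt * elt) : exists p, supported z k x.1 ->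
    supported z k x.2 -> x.1.2 = x.2.2 -> ~ eeq x.1 x.2 ->
    (erank p <= k)%N /\ forall us, (exists i, (i < size us)%N /\ nth hset0 us i = entry z p) ->
      cmp_matrix us x.1.1 <> cmp_matrix us x.2.1.
  have [[s1 [s2 [e ne]]]|H] := pselect (supported z k x.1 /\ supported z k x.2 /\
      x.1.2 = x.2.2 /\ ~ eeq x.1 x.2).
    by have [p Hp] := row_separation s1 s2 e ne; exists p.
  by exists (0, [::]) => s1 s2 e ne; exfalso; apply: H.
pose ps := [seq p <- [seq sep (x.1, y.1) | x <- Q, y <- Q] ++
  flatten [seq x.1.1 | x <- P] | (erank p <= k)%N].
pose es := [seq entry z p | p <- ps].
pose B' := (B + \sum_(x <- P) x.1.2 + \sum_(x <- Q) x.1.2)%N.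
have [q [Bq qs qm qu qd]] := payload_exists s (nseq (size ps) false)
  [seq (x.1.2, cmp_matrix es x.1.1) | x <- Q & x.2]
  [seq (x.1.2, cmp_matrix (elt_of z x.1).1 es) | x <- P & x.2] B'.
exists (ps, q); split => //=.
- apply/andP; split; first by apply/allP => p; rewrite mem_filter => /andP[].
  rewrite /marks_ok /= qm size_nseq eqxx /=.
  by elim: (ps).
- by apply: leq_ltn_trans Bq; rewrite /B' -addnA leq_addr.
- move=> x xP; have xq : (x.1.2 < q)%N.
    apply: leq_ltn_trans Bq; rewrite /B' addnAC; apply: leq_trans (leq_addl _ _).
    by rewrite (big_rem x) //= leq_addr.
  rewrite /emem /= ltnNge (ltnW xq) /= qd.
  apply/mapP/idP => [[y]|xb]; last by exists x => //; rewrite mem_filter xb.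
  rewrite mem_filter => /andP[yb yP] [e eM].
  suff /(HPc x y xP yP) -> : eeq (elt_of z x.1) (elt_of z y.1) by [].
  have [rx /andP[/eqP mx _]] := HP x xP; have [_ /andP[/eqP my _]] := HP y yP.
  apply: contrapT => ne; apply: (column_separation _ e ne _ eM); first by rewrite mx my e.
  move=> p px; rewrite mem_filter (allP rx) //= mem_cat; apply/orP; right.
  by apply/flattenP; exists x.1.1 => //; exact: map_f.
- move=> x xQ; have xq : (x.1.2 < q)%N.
    apply: leq_ltn_trans Bq; rewrite /B'; apply: leq_trans (leq_addl _ _).
    by rewrite (big_rem x) //= leq_addr.
  rewrite /emem /= xq qu.
  apply/mapP/idP => [[y]|xb]; last by exists x => //; rewrite mem_filter xb.
  rewrite mem_filter => /andP[yb yQ] [e eM].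
  suff /(HQc x y xQ yQ) -> : eeq x.1 y.1 by [].
  apply: contrapT => ne.
  have [pk Hp] := Hsep (x.1, y.1) (HQ x xQ) (HQ y yQ) e ne.
  apply: (Hp es _ eM); set p := sep _ in pk *.
  have pps : p \in ps.
    rewrite mem_filter pk mem_cat; apply/orP; left.
    by apply/allpairsP; exists (x, y).
  exists (index p ps); rewrite size_map index_mem; split=> //.
  by rewrite (nth_map (0, [::])) ?index_mem // nth_index.
Qed.
End RootSystem.

(** * Generic enumerations *)

Definition generic_for (D : nat -> set lstruct) (g : nat -> seq bool -> bool) :=
  forall m n x (qs : nat -> nat) (a : nat -> nat -> bool),
    (forall j j', (j < j')%N -> (j' < n)%N -> qs j <> qs j' \/ ~ a j =1 a j') ->
    exists n' x', (n <= n')%N /\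
      (forall i j, (i < n')%N -> (j < n)%N -> x' 0 i j = lbl str g (qs j) (a j) i) /\
      (forall k i j, (0 < k < n)%N -> (i < n)%N -> (j < n)%N -> x' k i j = x k i j) /\
      forall y, agree n' x' y -> D m y.

Definition label g (u : elt) : nat -> bool := lbl str g u.2 (ebits u.1).

Lemma label_eeq g u v : eeq u v -> label g u =1 label g v.
Proof.
move=> [e H] i; rewrite /label /lbl e; case: ifP => // _; congr (g _ _).
by apply: eq_mkseq; exact: ebits_heq.
Qed.

Section Enumeration.
Variables (Z : Type) (rho : nat -> nat) (root : nat -> Z -> hset).
Hypothesis root_rk : forall m z, rk (root m z) = rho m.
Variables (D : nat -> set lstruct) (g : nat -> seq bool -> bool).
Hypothesis gen : generic_for D g.

Local Notation elt_of := (elt_of root).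
Local Notation valid := (valid rho).

Definition sgen (z : Z) (A : nat -> nat -> code) : lstruct := fun k i j =>
  if k is k'.+1 then emem (elt_of z (A k' i)) (elt_of z (A k j))
  else label g (elt_of z (A 0 j)) i.

Record partial_copy z (x : lstruct) N (A : nat -> nat -> code) (dom : seq (nat * nat)) : Prop := {
  pc_bound : forall k j, (k, j) \in dom -> (k < N)%N /\ (j < N)%N;
  pc_valid : forall k j, (k, j) \in dom -> valid k (A k j);
  pc_inj : forall k j j', (k, j) \in dom -> (k, j') \in dom ->
    eeq (elt_of z (A k j)) (elt_of z (A k j')) -> j = j';
  pc_label : forall i j, (0, j) \in dom -> (i < N)%N ->
    label g (elt_of z (A 0 j)) i = x 0 i j;
  pc_mem : forall k i j, (k, i) \in dom -> (k.+1, j) \in dom ->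
    emem (elt_of z (A k i)) (elt_of z (A k.+1 j)) = x k.+1 i j }.

Lemma partial_copy_eq_dom z x N A dom dom' :
  dom =i dom' -> partial_copy z x N A dom -> partial_copy z x N A dom'.
Proof.
move=> e [H1 H2 H3 H4 H5]; split.
- by move=> k j; rewrite -e; exact: H1.
- by move=> k j; rewrite -e; exact: H2.
- by move=> k j j'; rewrite -!e; exact: H3.
- by move=> i j; rewrite -e; exact: H4.
- by move=> k i j; rewrite -!e; exact: H5.
Qed.

Definition update (A : nat -> nat -> code) k j w : nat -> nat -> code :=
  fun k' j' => if (k', j') == (k, j) then w else A k' j'.

Lemma update_dom A k j w (dom : seq (nat * nat)) k' j' : (k, j) \notin dom -> (k', j') \in dom ->
  update A k j w k' j' = A k' j'.
Proof. by rewrite /update => kjn; case: eqP => // -> /(negP kjn). Qed.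

Lemma updateE A k j w : update A k j w k j = w.
Proof. by rewrite /update eqxx. Qed.

Lemma extend_copy1 z x N A dom k j : (k < N)%N -> (j < N)%N -> (k, j) \notin dom ->
  partial_copy z x N A dom ->
  exists w, partial_copy z x N (update A k j w) ((k, j) :: dom).
Proof.
move=> kN jN kjn [Hb Hv Hi Hl Hm].
have memE k' l : (k', l) \in dom -> l \in iota 0 N.
  by move=> /Hb[_]; rewrite mem_iota.
pose P := [seq (A k.-1 i, x k i j) | i <- iota 0 N & (0 < k)%N && ((k.-1, i) \in dom)].
pose Q := [seq (elt_of z (A k.+1 l), x k.+1 j l) | l <- iota 0 N & (k.+1, l) \in dom].
pose B := (\sum_(p <- dom) (A p.1 p.2).2)%N.
have [| | | |w [wv ws wB wP wQ]] :=
    @one_point_extension Z rho root root_rk z k P Q (mkseq (fun i => x 0 i j) N) B.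
- move=> _ /mapP[i + ->] /=; rewrite mem_filter => /andP[/andP[k0 id] _].
  have /andP[/allP H1 H2] := Hv _ _ id; split=> //.
  apply/allP => p /H1; lia.
- move=> _ _ /mapP[i + ->] /mapP[i' + ->] /=; rewrite !mem_filter.
  by move=> /andP[/andP[k0 id] _] /andP[/andP[_ id'] _] /(Hi _ _ _ id id') ->.
- move=> _ /mapP[l + ->] /=; rewrite mem_filter => /andP[ld _].
  by apply: (valid_supported root_rk); exact: Hv.
- move=> _ _ /mapP[l + ->] /mapP[l' + ->] /=; rewrite !mem_filter.
  by move=> /andP[ld _] /andP[ld' _] /(Hi _ _ _ ld ld') ->.
exists w.
have qB k' l : (k', l) \in dom -> ((A k' l).2 < w.2)%N.
  by move=> ld; apply: leq_ltn_trans wB; rewrite /B (big_rem (k', l)) //= leq_addr.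
have neq l : (k, l) \in dom -> ~ (elt_of z (A k l)).2 = (elt_of z w).2.
  by move=> /qB /= + e; rewrite e ltnn.
split.
- by move=> k' l; rewrite inE => /predU1P[[-> ->]//|/Hb].
- move=> k' l; rewrite inE => /predU1P[[-> ->]|ld]; first by rewrite updateE.
  by rewrite (update_dom _ _ kjn ld); exact: Hv.
- move=> k' l l'; rewrite !inE => /predU1P[[ek el]|ld] /predU1P[[ek' el']|ld'].
  + by rewrite el el'.
  + subst k' l; rewrite updateE (update_dom _ _ kjn ld').
    by move=> [/esym e _]; case: (neq _ ld' e).
  + subst k' l'; rewrite updateE (update_dom _ _ kjn ld).
    by move=> [e _]; case: (neq _ ld e).
  + by rewrite (update_dom _ _ kjn ld) (update_dom _ _ kjn ld'); exact: Hi.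
- move=> i l; rewrite inE => /predU1P[[ek el]|ld] iN; last first.
    by rewrite (update_dom _ _ kjn ld) Hl.
  by subst k l; rewrite updateE /label /lbl /= ws size_mkseq iN nth_mkseq.
- move=> k' i l; rewrite !inE => /predU1P[[ek el]|id] /predU1P[[ek' el']|ld].
  + by exfalso; lia.
  + subst k' i; rewrite updateE (update_dom _ _ kjn ld).
    apply: (wQ (_, _)); apply/mapP; exists l => //.
    by rewrite mem_filter ld (memE _ _ ld).
  + subst k l; rewrite updateE (update_dom _ _ kjn id).
    apply: (wP (_, _)); apply/mapP; exists i => //.
    by rewrite mem_filter /= id (memE _ _ id).
  + by rewrite (update_dom _ _ kjn id) (update_dom _ _ kjn ld) Hm.
Qed.

Lemma extend_copy z x N A dom ls :
  (forall k j, (k, j) \in ls -> (k < N)%N /\ (j < N)%N) ->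
  partial_copy z x N A dom ->
  exists A', (forall k j, (k, j) \in dom -> A' k j = A k j) /\
    partial_copy z x N A' (ls ++ dom).
Proof.
elim: ls => [|[k j] ls IHls] Hls pc; first by exists A.
have [|A' [eA pc']] := IHls _ pc.
  by move=> k' j' ?; apply: Hls; rewrite inE; apply/orP; right.
have [kjd|kjn] := boolP ((k, j) \in ls ++ dom).
  exists A'; split=> //; apply: partial_copy_eq_dom pc' => p.
  by rewrite [in RHS]inE; case: eqP => [->|].
have [kN jN] := Hls k j (mem_head _ _).
have [w pcw] := extend_copy1 kN jN kjn pc'.
exists (update A' k j w); split=> // k' j' d; rewrite (update_dom _ _ kjn) ?eA //.
by rewrite mem_cat d orbT.
Qed.

Definition grid n : seq (nat * nat) := [seq (k, j) | k <- iota 0 n, j <- iota 0 n].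

Lemma mem_grid n k j : ((k, j) \in grid n) = (k < n)%N && (j < n)%N.
Proof.
apply/allpairsP/andP => [[[k' j']] /= []|[kn jn]].
  by rewrite !mem_iota => ? ? [-> ->].
by exists (k, j); rewrite !mem_iota.
Qed.

Definition independent z n (A : nat -> nat -> code) :=
  (forall k j, (k < n)%N -> (j < n)%N -> valid k (A k j)) /\
  (forall k j j', (k < n)%N -> (j < n)%N -> (j' < n)%N ->
    eeq (elt_of z (A k j)) (elt_of z (A k j')) -> j = j').

Definition same_upto n (A A' : nat -> nat -> code) :=
  forall k j, (k < n)%N -> (j < n)%N -> A' k j = A k j.

Lemma sgen_same z n A A' : same_upto n A A' -> agree n (sgen z A) (sgen z A').
Proof.
move=> e [|k] i j kn iln jn; rewrite /sgen !e //; exact: ltn_trans kn.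
Qed.

Lemma fill_copy z x N A dom : partial_copy z x N A dom ->
  exists A', (forall k j, (k, j) \in dom -> A' k j = A k j) /\
    independent z N A' /\ agree N x (sgen z A').
Proof.
move=> /(extend_copy (ls := grid N))[k j|A' [eA [_ Hv Hi Hl Hm]]].
  by rewrite mem_grid => /andP.
have gd k j : (k < N)%N -> (j < N)%N -> (k, j) \in grid N ++ dom.
  by move=> kN jN; rewrite mem_cat mem_grid kN jN.
exists A'; split=> //; split.
  split=> [k j kN jN|k j j' kN jN jN']; first exact/Hv/gd.
  by apply: Hi; exact: gd.
move=> [|k] i j kN iN jN /=; first by rewrite Hl //; exact: gd.
by rewrite Hm //; apply: gd => //; exact: ltn_trans kN.
Qed.

Lemma independent_copy z n N A x : (n <= N)%N -> independent z n A ->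
  (forall i j, (i < N)%N -> (j < n)%N -> x 0 i j = sgen z A 0 i j) ->
  (forall k i j, (k.+1 < n)%N -> (i < n)%N -> (j < n)%N -> x k.+1 i j = sgen z A k.+1 i j) ->
  partial_copy z x N A (grid n).
Proof.
move=> nN [Av Ai] x0 xS; split.
- by move=> k j; rewrite mem_grid => /andP[kn jn]; split; exact: leq_trans nN.
- by move=> k j; rewrite mem_grid => /andP[kn jn]; exact: Av.
- by move=> k j j'; rewrite !mem_grid => /andP[kn jn] /andP[_ jn']; exact: Ai.
- by move=> i j; rewrite mem_grid => /andP[_ jn] iN; rewrite x0.
- by move=> k i j; rewrite !mem_grid => /andP[_ iln] /andP[kn jn]; rewrite xS.
Qed.

Lemma independent_labels z n A j j' : independent z n A -> (j < j')%N -> (j' < n)%N ->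
  (A 0 j).2 <> (A 0 j').2 \/ ~ ebits (elt_of z (A 0 j)).1 =1 ebits (elt_of z (A 0 j')).1.
Proof.
move=> [Av Ai] jj jn; have jn' := ltn_trans jj jn; have n0 : (0 < n)%N by lia.
apply: contrapT => /not_orP[/contrapT e /contrapT eb].
have := Av 0 j n0 jn' => /andP[/allP r1 /andP[/eqP s1 _]].
have := Av 0 j' n0 jn => /andP[/allP r2 /andP[/eqP s2 _]].
suff /Ai : eeq (elt_of z (A 0 j)) (elt_of z (A 0 j')) by move=> /(_ n0 jn' jn) ?; lia.
have rk0 u : {in u.1, forall p, erank rho p <= 0}%N ->
    forall i, rk (nth hset0 (elt_of z u).1 i) = 0.
  move=> H i; have [iu|ui] := ltnP i (size u.1); last by rewrite nth_default ?size_elt_of.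
  rewrite nth_elt_of // (rk_entry root_rk); apply/eqP; rewrite -leqn0; apply: H; exact: mem_nth.
split=> //; apply: ebits_inj eb; [|exact: rk0|exact: rk0].
by rewrite !size_elt_of s1 s2 e.
Qed.

Lemma meet_dense z n A m : independent z n A ->
  exists n' A', (n < n')%N /\ independent z n' A' /\ same_upto n A A' /\
    forall y, agree n' (sgen z A') y -> D m y.
Proof.
move=> iA; have [|n' [x' [nn [H1 [H2 H3]]]]] := @gen m n (sgen z A)
    (fun j => (A 0 j).2) (fun j => ebits (elt_of z (A 0 j)).1).
  by move=> j j' jj jn; exact: independent_labels jn.
pose x : lstruct := fun k i j =>
  if (k == 0) && (j < n)%N then sgen z A 0 i j else x' k i j.
have [|A' [eA [iA' ax]]] := @fill_copy z x (maxn n' n.+1) A (grid n).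
  apply: independent_copy => //; first by lia.
    by move=> i j _ jn; rewrite /x jn.
  by move=> k i j kn iln jn; rewrite /x /= H2.
exists (maxn n' n.+1), A'; split; first by lia.
split=> //; split; first by move=> k j kn jn; apply: eA; rewrite mem_grid kn.
move=> y Ay; apply: H3; apply: agree_trans (agree_le (leq_maxl _ _) (agree_trans ax Ay)).
move=> k i j kn iln jn'; rewrite /x; case: eqP => //= k0.
by case: ifP => // jn; rewrite k0 H1.
Qed.

Lemma add_code z n A k u : independent z n A -> valid k u ->
  exists n' A', (n < n')%N /\ independent z n' A' /\ same_upto n A A' /\
    (k < n')%N /\ exists j, (j < n')%N /\ eeq (elt_of z u) (elt_of z (A' k j)).
Proof.
move=> iA vu; pose N := (maxn n k).+1.
have nN : (n <= N)%N by rewrite /N; lia.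
have [[kn [j [jn ej]]]|H] :=
    pselect ((k < n)%N /\ exists j, (j < n)%N /\ eeq (elt_of z u) (elt_of z (A k j))).
  have [|A' [eA [iA' _]]] := @fill_copy z (sgen z A) N A (grid n).
    by apply: independent_copy.
  have e : same_upto n A A' by move=> k' j' kn' jn'; apply: eA; rewrite mem_grid kn'.
  exists N, A'; split; first by rewrite /N; lia.
  split=> //; split=> //; split; first by rewrite /N; lia.
  by exists j; rewrite e //; split=> //; rewrite /N; lia.
have kng : (k, n) \notin grid n by rewrite mem_grid ltnn andbF.
pose A1 := update A k n u.
have A1e k' j' : (k', j') \in grid n -> A1 k' j' = A k' j'.
  exact: update_dom.
have [|A' [eA [iA' _]]] := @fill_copy z (sgen z A1) N A1 ((k, n) :: grid n).
  have [Av Ai] := iA.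
  have ne j : (k, j) \in grid n -> ~ eeq (elt_of z u) (elt_of z (A k j)).
    by rewrite mem_grid => /andP[kn jn] e; apply: H; split=> //; exists j.
  split=> //.
  - move=> k' j'; rewrite inE => /predU1P[[-> ->]|]; first by rewrite /N; lia.
    by rewrite mem_grid => /andP[kn jn]; rewrite /N; lia.
  - move=> k' j'; rewrite inE => /predU1P[[-> ->]|kj]; first by rewrite /A1 updateE.
    by rewrite A1e //; move: kj; rewrite mem_grid => /andP[]; exact: Av.
  - move=> k' j j'; rewrite !inE => /predU1P[[ek el]|ld] /predU1P[[ek' el']|ld'].
    + by rewrite el el'.
    + by subst k' j; rewrite /A1 updateE -/A1 A1e // => /ne.
    + by subst k' j'; rewrite {2}/A1 updateE A1e // => /eeq_sym/ne.
    + rewrite !A1e //; move: ld ld'; rewrite !mem_grid => /andP[kn jn] /andP[_ jn'].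
      exact: Ai.
exists N, A'; split; first by rewrite /N; lia.
split=> //; split.
  move=> k' j' kn jn; have kjg : (k', j') \in grid n by rewrite mem_grid kn.
  by rewrite eA ?A1e // inE kjg orbT.
split; first by rewrite /N; lia.
exists n; split; first by rewrite /N; lia.
by rewrite eA ?mem_head // /A1 updateE; exact: eeq_refl.
Qed.

Lemma start_copy z (O : set lstruct) x0 : open O -> O x0 ->
  exists n A, independent z n A /\ forall y, agree n (sgen z A) y -> O y.
Proof.
move=> oO /oO[n Hn].
have [|A [_ [iA aA]]] := @fill_copy z x0 n (fun _ _ => ([::], 0)) [::]; first by split.
by exists n, A; split=> // y Ay; apply: Hn; exact: agree_trans Ay.
Qed.

End Enumeration.

(** * Borel choice of the enumeration *)

Definition discrete_borel (Z : topologicalType) (S : Type) (F : Z -> S) :=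
  forall P : S -> Prop, borel [set z | P (F z)].

Lemma discrete_borel_cst (Z : topologicalType) (S : Type) (s : S) :
  discrete_borel (fun _ : Z => s).
Proof. by move=> P; exact: borel_const. Qed.

Lemma discrete_borel_asbool (Z : topologicalType) (Q : Z -> Prop) :
  borel [set z | Q z] -> discrete_borel (fun z => `[< Q z >]).
Proof.
move=> bQ P; rewrite (_ : [set z | _] = [set z | (Q z /\ P true) \/ (~ Q z /\ P false)]).
  by apply: borel_or; apply: borel_and; (exact: bQ || exact: borel_const || exact: borel_not).
apply/seteqP; split=> z /=; case: asboolP => q; try by [left|right].
  by case=> -[].
by case=> -[].
Qed.

Lemma discrete_borel_pair (Z : topologicalType) (S : countType) (S' : Type)
    (F : Z -> S) (G : Z -> S') :
  discrete_borel F -> discrete_borel G -> discrete_borel (fun z => (F z, G z)).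
Proof.
move=> bF bG P; rewrite (_ : [set z | _] = [set z | exists s, F z = s /\ P (s, G z)]).
  apply: borel_exists => s; apply: borel_and; first exact: (bF (fun t => t = s)).
  exact: (bG (fun t => P (s, t))).
by apply/seteqP; split=> z /= => [|[s [->]]//]; exists (F z).
Qed.

Lemma discrete_borel_mkseq (Z : topologicalType) (S : countType) (F : nat -> Z -> S) n :
  (forall i, discrete_borel (F i)) -> discrete_borel (fun z => mkseq (fun i => F i z) n).
Proof.
move=> bF; elim: n => [|n IHn] P.
  by rewrite (_ : [set z | _] = [set z | P [::]]) //; exact: borel_const.
rewrite (_ : [set z | _] = [set z |
    (fun p : seq S * S => P (rcons p.1 p.2)) (mkseq (fun i => F i z) n, F n z)]).
  exact: (discrete_borel_pair IHn (bF n) (fun p => P (rcons p.1 p.2))).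
by apply/seteqP; split=> z /=; rewrite mkseqS.
Qed.

Lemma borel_least (Z : topologicalType) (S : countType) (d : S) (G : Z -> S -> Prop) :
  (forall s, borel [set z | G z s]) ->
  exists F : Z -> S, (forall z, (exists s, G z s) -> G z (F z)) /\ discrete_borel F.
Proof.
move=> bG.
pose H z n := exists s, @unpickle S n = Some s /\ G z s.
have bH n : borel [set z | H z n].
  by apply: borel_exists => s; apply: borel_and; [exact: borel_const|exact: bG].
pose least z n := H z n /\ forall i : 'I_n, ~ H z i.
have bl n : borel [set z | least z n].
  apply: borel_and; first exact: bH.
  by apply: borel_forall => i; apply: borel_not; exact: bH.
have ex_least z : (exists s, G z s) -> exists n, least z n.
  move=> [s Gs]; have ex : exists n, `[< H z n >].
    by exists (pickle s); apply/asboolP; exists s; rewrite pickleK.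
  case: (ex_minnP ex) => n /asboolP Hn nmin; exists n; split=> // i Hi.
  by have := nmin i (asboolT Hi); rewrite leqNgt ltn_ord.
have /choice[F HF] z : exists s, (exists n, least z n /\ @unpickle S n = Some s) \/
    ((~ exists s, G z s) /\ s = d).
  have [/ex_least[n ln]|nG] := pselect (exists s, G z s); last by exists d; right.
  have [[s [e _]] _] := ln.
  by exists s; left; exists n.
exists F; split=> [z ex|P].
  have [[n [[[s [e Gs]] _]]]|[]//] := HF z.
  by rewrite e => -[<-].
have least_uniq z n n' : least z n -> least z n' -> n = n'.
  move=> [Hn ln] [Hn' ln']; apply/eqP; rewrite eqn_leq; apply/andP; split; rewrite leqNgt.
    by apply/negP => lt; apply: (ln (Ordinal lt)).
  by apply/negP => lt; apply: (ln' (Ordinal lt)).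
rewrite (_ : [set z | _] = [set z |
   (exists n, least z n /\ exists s, @unpickle S n = Some s /\ P s) \/
   ((~ exists s, G z s) /\ P d)]).
  apply: borel_or.
    by apply: borel_exists => n; apply: borel_and; [exact: bl|exact: borel_const].
  apply: borel_and; last exact: borel_const.
  by apply: borel_not; exact: borel_exists.
apply/seteqP; split=> z /=; have [[n [ln e]]|[nG e]] := HF z.
- by move=> PF; left; exists n; split=> //; exists (F z).
- by rewrite e => Pd; right.
- move=> [[n' [ln' [s [e' Ps]]]]|[nG _]].
    by move: e'; rewrite -(least_uniq _ _ _ ln ln') e => -[->].
  by exfalso; apply: nG; have [[s [? ?]] _] := ln; exists s.
- move=> [[n' [[[s [? ?]] _] _]]|[_ Pd]]; last by rewrite e.
  by exfalso; apply: nG; exists s.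
Qed.

Section BorelEnumeration.
Variables (Z : topologicalType) (rho : nat -> nat) (root : nat -> Z -> hset).
Hypothesis root_rk : forall m z, rk (root m z) = rho m.
Hypothesis root_borel : forall m, borel_hset (root m).
Variables (D : nat -> set lstruct) (g : nat -> seq bool -> bool).
Hypothesis gen : generic_for D g.
Variables (O : set lstruct) (x0 : lstruct).
Hypotheses (oO : open O) (Ox0 : O x0).

Local Notation elt_of := (elt_of root).
Local Notation valid := (valid rho).
Local Notation sgen := (sgen root g).
Local Notation independent := (independent rho root).

Lemma borel_entry p : borel_hset (fun z => entry root z p).
Proof.
case: p => m s; elim/last_ind: s => [|s i IHs]; first exact: root_borel.
have [k [f [bf H]]] := borel_hchild i IHs.
by exists k, f; split=> // z; rewrite -H entry_rcons.
Qed.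

Lemma borel_nth_elt_of u i : borel_hset (fun z => nth hset0 (elt_of z u).1 i).
Proof.
have [iu|ui] := ltnP i (size u.1).
  have [k [f [bf H]]] := borel_entry (nth (0, [::]) u.1 i).
  by exists k, f; split=> // z; rewrite nth_elt_of.
exists 0, (fun=> 0%R : R); split; first exact: borel_fun_cst.
by move=> z; rewrite nth_default // size_elt_of.
Qed.

Lemma borel_eeq u v : borel [set z | eeq (elt_of z u) (elt_of z v)].
Proof.
apply: borel_and; first exact: (@borel_const _ (u.2 = v.2)).
rewrite (_ : [set z | _] = [set z | size u.1 = size v.1 /\
    forall i, heq (nth hset0 (elt_of z u).1 i) (nth hset0 (elt_of z v).1 i)]).
  apply: borel_and; first exact: borel_const.
  by apply: borel_forall => i; apply: borel_heq; exact: borel_nth_elt_of.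
by apply/seteqP; split=> z; rewrite /= /seq_heq !size_elt_of.
Qed.

Lemma discrete_borel_cmp_matrix u v :
  discrete_borel (fun z => cmp_matrix (elt_of z u).1 (elt_of z v).1).
Proof.
rewrite (_ : (fun z => _) = fun z =>
  mkseq (fun i => mkseq (fun j =>
    (`[< heq (nth hset0 (elt_of z u).1 i) (nth hset0 (elt_of z v).1 j) >],
     `[< hmem (nth hset0 (elt_of z u).1 i) (nth hset0 (elt_of z v).1 j) >])) (size v.1)) (size u.1)).
  apply: (@discrete_borel_mkseq Z (seq (bool * bool))) => i.
  apply: (@discrete_borel_mkseq Z (bool * bool)%type) => j.
  apply: discrete_borel_pair; apply: discrete_borel_asbool.
    by apply: borel_heq; exact: borel_nth_elt_of.
  by apply: borel_hmem; exact: borel_nth_elt_of.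
by apply/funext => z; rewrite /cmp_matrix !size_elt_of.
Qed.

Lemma borel_emem u v : borel [set z | emem (elt_of z u) (elt_of z v)].
Proof.
exact: (discrete_borel_cmp_matrix u v (fun M => (if (v.2 < u.2)%N
  then (v.2, M) \in up u.2 else (u.2, M) \in down v.2) : bool)).
Qed.

Lemma borel_label u i : borel [set z | label g (elt_of z u) i].
Proof.
have bb j : discrete_borel (fun z => ebits (elt_of z u).1 j).
  rewrite /ebits; case: (@unpickle (nat * rat)%type j) => [[l r]|]; last exact: discrete_borel_cst.
  rewrite (_ : (fun z => _) = fun z => `[< hbit (nth hset0 (elt_of z u).1 l) r >]).
    by apply: discrete_borel_asbool; apply: borel_hbit; exact: borel_nth_elt_of.
  by apply/funext => z; rewrite asboolb.
exact: (discrete_borel_mkseq i bb (fun s => (if (i < size (str u.2))%N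
  then nth false (str u.2) i else g u.2 s) : bool)).
Qed.

Lemma borel_sgen_coord A k i j : borel [set z | sgen z A k i j].
Proof. by case: k => [|k]; [exact: borel_label|exact: borel_emem]. Qed.

Lemma borel_sgen A : borel_fun (fun z => sgen z A).
Proof. by apply: borel_fun_lstruct => k i j; exact: borel_sgen_coord. Qed.

Lemma borel_independent n A : borel [set z | independent z n A].
Proof.
apply: borel_and; first exact: borel_const.
apply: borel_forall => k; apply: borel_forall => j; apply: borel_forall => j'.
do 3 (apply: borel_imply; first exact: borel_const).
apply: borel_imply; first exact: borel_eeq.
exact: borel_const.
Qed.

Lemma borel_cylinder_sub (E : set lstruct) n A :
  borel [set z | forall y, agree n (sgen z A) y -> E y].
Proof.
have oE : open [set x | forall y, agree n x y -> E y].
  apply/lstruct_openE => x Ex; exists n => y xy w yw; apply: Ex; exact: agree_trans yw.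
exact: (borel_sgen A (borel_open oE)).
Qed.

Let state := (nat * seq (seq code))%type.

Definition read (s : seq (seq code)) (k j : nat) : code := nth ([::], 0) (nth [::] s k) j.

Definition write n (A : nat -> nat -> code) : seq (seq code) :=
  mkseq (fun k => mkseq (A k) n) n.

Lemma read_write n A : same_upto n A (read (write n A)).
Proof. by move=> k j kn jn; rewrite /read /write !nth_mkseq. Qed.

Lemma write_independent z n A : independent z n A -> independent z n (read (write n A)).
Proof.
move=> [H1 H2]; split=> [k j kn jn|k j j' kn jn jn']; rewrite !read_write //.
  exact: H1.
exact: H2.
Qed.

Let task := (nat * nat * code)%type.

Definition good z (t : task) (s s' : state) : Prop :=
  let: (m, k, u) := t in
  (s.1 < s'.1)%N /\ independent z s'.1 (read s'.2) /\
  same_upto s.1 (read s.2) (read s'.2) /\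
  (forall y, agree s'.1 (sgen z (read s'.2)) y -> D m y) /\
  (valid k u -> (k < s'.1)%N /\
    exists j, (j < s'.1)%N /\ eeq (elt_of z u) (elt_of z (read s'.2 k j))).

Lemma borel_good t s s' : borel [set z | good z t s s'].
Proof.
case: t => -[m k] u; apply: borel_and; first exact: borel_const.
apply: borel_and; first exact: borel_independent.
apply: borel_and; first exact: borel_const.
apply: borel_and; first exact: borel_cylinder_sub.
apply: borel_imply; first exact: borel_const.
apply: borel_and; first exact: borel_const.
apply: borel_exists => j; apply: borel_and; first exact: borel_const.
exact: borel_eeq.
Qed.

Lemma good_exists z t s : independent z s.1 (read s.2) -> exists s', good z t s s'.
Proof.
case: t => -[m k] u i0.
have [n1 [A1 [n01 [i1 [s01 H1]]]]] : exists n' A', (s.1 < n')%N /\ independent z n' A' /\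
    same_upto s.1 (read s.2) A' /\ (valid k u -> (k < n')%N /\
    exists j, (j < n')%N /\ eeq (elt_of z u) (elt_of z (A' k j))).
  have [vu|nv] := boolP (valid k u).
    have [n' [A' [? [? [? [? ?]]]]]] := add_code root_rk g i0 vu.
    by exists n', A'.
  have [n' [A' [? [? [? ?]]]]] := meet_dense root_rk gen 0 i0.
  by exists n', A'.
have [n2 [A2 [n12 [i2 [s12 H2]]]]] := meet_dense root_rk gen m i1.
exists (n2, write n2 A2); split=> /=; first exact: ltn_trans n12.
split; first exact: write_independent.
have rw := @read_write n2 A2.
split; first by move=> k' j kn jn; rewrite rw ?s12 ?s01 //; lia.
split; first by move=> y Ay; apply: H2; exact: agree_trans (sgen_same root g z rw) Ay.
move=> /H1[kn [j [jn e]]]; split; first exact: ltn_trans n12.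
by exists j; rewrite rw ?s12 //; [split=> //; exact: ltn_trans n12|exact: ltn_trans n12|exact: ltn_trans n12].
Qed.

Lemma borel_start : exists F : Z -> state, discrete_borel F /\ forall z,
  independent z (F z).1 (read (F z).2) /\
  forall y, agree (F z).1 (sgen z (read (F z).2)) y -> O y.
Proof.
have [|F [HF bF]] := @borel_least Z state (0, [::])
    (fun z s => independent z s.1 (read s.2) /\
      forall y, agree s.1 (sgen z (read s.2)) y -> O y).
  by move=> s; apply: borel_and; [exact: borel_independent|exact: borel_cylinder_sub].
exists F; split=> // z; apply: HF.
have [n [A [iA AO]]] := start_copy root_rk g z oO Ox0.
exists (n, write n A); split; first exact: write_independent.
move=> y Ay; apply: AO; exact: agree_trans (sgen_same root g z (@read_write n A)) Ay.
Qed.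

Lemma borel_step (t : task) (F : Z -> state) : discrete_borel F ->
  (forall z, independent z (F z).1 (read (F z).2)) ->
  exists F' : Z -> state, discrete_borel F' /\ forall z, good z t (F z) (F' z).
Proof.
move=> bF iF.
have [|F' [HF' bF']] := @borel_least Z state (0, [::]) (fun z s' => good z t (F z) s').
  move=> s'; rewrite (_ : [set z | _] = [set z | exists s, F z = s /\ good z t s s']).
    apply: borel_exists => s; apply: borel_and; first exact: (bF (fun t => t = s)).
    exact: borel_good.
  by apply/seteqP; split=> z /= => [|[s [->]]//]; exists (F z).
by exists F'; split=> // z; apply: HF'; exact: good_exists.
Qed.

Lemma generic_enumeration : exists U : Z -> nat -> nat -> code,
  borel_fun (fun z => sgen z (U z)) /\
  forall z, [/\ O (sgen z (U z)), forall m, D m (sgen z (U z)),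
    forall k j, valid k (U z k j) &
    forall k u, valid k u -> exists j, eeq (elt_of z u) (elt_of z (U z k j))].
Proof.
have [F0 [bF0 HF0]] := borel_start.
pose inv (F : Z -> state) := discrete_borel F /\ forall z, independent z (F z).1 (read (F z).2).
have /choice[step Hstep] (tF : task * (Z -> state)) : exists F', inv tF.2 ->
    inv F' /\ forall z, good z tF.1 (tF.2 z) (F' z).
  have [[bF iF]|] := pselect (inv tF.2); last by exists F0.
  have [F' [bF' gF']] := borel_step tF.1 bF iF; exists F' => _; split=> //; split=> // z.
  by have := gF' z; case: (tF.1) => -[m k] u [_ []].
pose tasks t : task := if @unpickle task t is Some T then T else (0, 0, ([::], 0)).
pose F := fix F t := if t is t'.+1 then step (tasks t', F t') else F0.
have FS t : F t.+1 = step (tasks t, F t) by [].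
have invF t : inv (F t).
  elim: t => [|t IHt]; first by split=> // z; have [] := HF0 z.
  by rewrite FS; have [] := Hstep (tasks t, F t) IHt.
have goodF t z : good z (tasks t) (F t z) (F t.+1 z).
  by rewrite FS; have [_] := Hstep (tasks t, F t) (invF t); apply.
have growS t z : ((F t z).1 < (F t.+1 z).1)%N /\
    same_upto (F t z).1 (read (F t z).2) (read (F t.+1 z).2).
  by have := goodF t z; case: (tasks t) => -[m k] u [? [_ [? _]]].
have grow t t' z : (t <= t')%N -> ((F t z).1 <= (F t' z).1)%N /\
    same_upto (F t z).1 (read (F t z).2) (read (F t' z).2).
  move=> /subnK <-; elim: (t' - t) => [|d [IH1 IH2]] //.
  have [H1 H2] := growS (d + t) z; rewrite addSn; split; first by lia.
  by move=> k j kn jn; rewrite H2 ?IH2 //; lia.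
have size_F t z : (t <= (F t z).1)%N.
  by elim: t => // t; have [] := growS t z; lia.
pose U z k j := read (F (k + j).+1 z).2 k j.
have UE t z : same_upto (F t z).1 (read (F t z).2) (U z).
  move=> k j kn jn; rewrite /U; have := size_F (k + j).+1 z => sF.
  have [st|/ltnW ts] := leqP (k + j).+1 t.
    by have [_ e] := grow _ _ z st; rewrite e //; lia.
  by have [_ e] := grow _ _ z ts; rewrite e.
have agU t z : agree (F t z).1 (sgen z (read (F t z).2)) (sgen z (U z)).
  exact: sgen_same.
exists U; split.
  apply: borel_fun_lstruct => k i j.
  pose T := (k + i + j).+1.
  rewrite (_ : [set z | _] = [set z | exists s, F T z = s /\ sgen z (read s.2) k i j]).
    apply: borel_exists => s; apply: borel_and; last exact: borel_sgen_coord.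
    by have [bF _] := invF T; exact: (bF (fun t => t = s)).
  have e z : sgen z (read (F T z).2) k i j = sgen z (U z) k i j.
    by apply: agU; have := size_F T z; rewrite /T; lia.
  apply/seteqP; split=> z /=; first by rewrite -e => H; exists (F T z).
  by case=> s [<-]; rewrite e.
move=> z; split.
- by have [_ H] := HF0 z; apply: H; exact: (agU 0).
- move=> m; pose T : task := (m, 0, ([::], 0)).
  have := goodF (pickle T) z; rewrite /tasks pickleK => -[_ [_ [_ [H _]]]].
  by apply: H; exact: agU.
- move=> k j; have sF := size_F (k + j).+1 z.
  have [_ /(_ z)[iv _]] := invF (k + j).+1; apply: iv; lia.
- move=> k u vu; pose T : task := (0, k, u).
  have := goodF (pickle T) z; rewrite {1}/tasks pickleK => -[_ [_ [_ [_ /(_ vu)]]]].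
  move=> [kn [j [jn e]]]; exists j; rewrite (UE _ _ _ _ kn jn) //.
Qed.

End BorelEnumeration.

(** * Decoding *)

Fixpoint dflt k : plus_space k :=
  match k return plus_space k with
  | 0 => (-1)%R : R
  | m.+1 => fun _ => dflt m
  end.

(* [kappa] is nonnegative, so [-1] labels nothing. The default value at index 0
   makes the decoded set depend only on the members, even if all indices are
   members. *)
Fixpoint dec k (y : lstruct) (j : nat) : plus_space k :=
  match k return plus_space k with
  | 0 => kappa (fun i => y 0 i j)
  | m.+1 => fun i => if i is i'.+1 then
                       (if y m.+1 i' j then dec m y i' else dflt m)
                     else dflt m
  end.

Definition level k (y : lstruct) : plus_space k.+1 := fun j => dec k y j.

Lemma borel_dec k j : borel_fun (fun y => dec k y j).
Proof.
elim: k j => [|k IHk] j.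
  apply: (@borel_kappa lstruct (fun y i => y 0 i j)) => i; exact: borel_fun_coord3.
apply: (@borel_fun_prod lstruct (fun=> plus_space k)) => [i|[|i]].
- exact: countably_based_plus.
- exact: borel_fun_cst.
- apply: borel_fun_if; [exact: borel_fun_coord3|exact: IHk|exact: borel_fun_cst].
Qed.

Lemma borel_level k : borel_fun (level k).
Proof.
apply: (@borel_fun_prod lstruct (fun=> plus_space k)) => [i|i].
  exact: countably_based_plus.
exact: borel_dec.
Qed.

Definition distinct_labels : set lstruct := [set y | exists i, y 0 i 0 <> y 0 i 1].

Lemma distinct_labels_dense : dense_cylinders distinct_labels.
Proof.
move=> x n; exists n.+2, (fun k i j => if i == n then j == 0 else x k i j).
split; first by lia.
split; first by move=> k i j kn iln jn; case: eqP => // e; exfalso; lia.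
move=> y xy; exists n; rewrite -!xy //; by rewrite eqxx.
Qed.

Lemma label_inj D g u v : generic_for D g -> D 0 = distinct_labels ->
  size u.1 = size (marks u.2) -> size v.1 = size (marks v.2) ->
  (forall i, rk (nth hset0 u.1 i) = 0) -> (forall i, rk (nth hset0 v.1 i) = 0) ->
  label g u =1 label g v -> eeq u v.
Proof.
move=> gen D0 su sv ru rv euv; apply: contrapT => ne.
have [|n' [x' [n2 [H1 [_ H3]]]]] := @gen 0 2 (fun _ _ _ => false)
    (fun j => if j is 0 then u.2 else v.2) (fun j => ebits (if j is 0 then u.1 else v.1)).
  move=> j j' jj j2; have [-> ->] : j = 0 /\ j' = 1 by lia.
  apply: contrapT => /not_orP[/contrapT e /contrapT eb]; apply: ne; split=> //.
  by apply: ebits_inj => //; rewrite su sv e.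
have [i] : distinct_labels (fun k i j => if (i < n')%N then x' k i j else false).
  by rewrite -D0; apply: H3 => k i j _ ->.
case: ifP => // iln; apply; rewrite !H1 //; exact: euv.
Qed.

Section Decoding.
Variables (Z : Type) (rho : nat -> nat) (root : nat -> Z -> hset).
Hypothesis root_rk : forall m z, rk (root m z) = rho m.
Variables (D : nat -> set lstruct) (g : nat -> seq bool -> bool).
Hypotheses (gen : generic_for D g) (D0 : D 0 = distinct_labels).
Variable U : Z -> nat -> nat -> code.
Hypothesis U_valid : forall z k j, valid rho k (U z k j).
Hypothesis U_onto : forall z k u, valid rho k u ->
  exists j, eeq (elt_of root z u) (elt_of root z (U z k j)).

Local Notation elt_of := (elt_of root).
Local Notation valid := (valid rho).
Local Notation entry := (entry root).
Local Notation erank := (erank rho).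

Let el z k j := elt_of z (U z k j).
Definition generic_copy z : lstruct := sgen root g z (U z).
Arguments generic_copy : simpl never.
Local Notation gs := generic_copy.

Lemma member_exists z k j : exists i, gs z k.+1 i j.
Proof.
have [| | | |w [wv _ _ _ wQ]] := @one_point_extension Z rho root root_rk z k [::]
    [:: (el z k.+1 j, true)] [::] 0; rewrite //.
- by move=> x; rewrite inE => /eqP ->; exact: valid_supported.
- by move=> x y; rewrite !inE => /eqP -> /eqP ->.
have [i ei] := U_onto z wv; exists i.
rewrite /generic_copy /= -(emem_eeq ei (eeq_refl _)).
by apply: (wQ (_, _)); rewrite inE.
Qed.

Lemma container_exists z k i : exists j, gs z k.+1 i j.
Proof.
have [| | | |w [wv _ _ wP _]] := @one_point_extension Z rho root root_rk z k.+1
    [:: (U z k i, true)] [::] [::] 0; rewrite //.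
- move=> x; rewrite inE => /eqP -> /=; have /andP[/allP H ->] := U_valid z k i.
  by split=> //; apply/allP => p /H; lia.
- by move=> x y; rewrite !inE => /eqP -> /eqP ->.
have [j ej] := U_onto z wv; exists j.
rewrite /generic_copy /= -(emem_eeq (eeq_refl _) ej).
by apply: (wP (_, _)); rewrite inE.
Qed.

Lemma dec_not_dflt z k j : ~ cmp (dec k (gs z) j) (dflt k).
Proof.
elim: k j => [|k IHk] j /=.
  by move=> e; have := kappa_ge0 (fun i => gs z 0 i j); rewrite e; lra.
move=> [+ _] => H; have [i ij] := member_exists z k j.
by have [_] := H i.+1; rewrite ij => /IHk.
Qed.

Lemma dec_member z z' k j j' i : cmp (dec k.+1 (gs z) j) (dec k.+1 (gs z') j') ->
  gs z k.+1 i j -> exists i', gs z' k.+1 i' j' /\ cmp (dec k (gs z) i) (dec k (gs z') i').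
Proof.
move=> [H _] ij; have [[|i']] := H i.+1; rewrite /= ij; first by move=> /dec_not_dflt.
by case: ifP => [i'j'|_ /dec_not_dflt//]; exists i'.
Qed.

Lemma level_down z z' k : cmp (level k.+1 (gs z)) (level k.+1 (gs z')) ->
  cmp (level k (gs z)) (level k (gs z')).
Proof.
have half w w' : cmp (level k.+1 (gs w)) (level k.+1 (gs w')) ->
    forall i, exists i', cmp (dec k (gs w) i) (dec k (gs w') i').
  move=> [H _] i; have [j ij] := container_exists w k i.
  have [j' jj'] := H j; have [i' [_ ii']] := dec_member jj' ij.
  by exists i'.
move=> H; split; first exact: half.
by move=> i; have [i' /cmp_sym ?] := half _ _ (cmp_sym H) i; exists i'.
Qed.

Definition level_match k z z' := forall j, exists j', eeq (el z k j) (el z' k j').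

Lemma match_code k z z' u : level_match k z z' -> valid k u ->
  exists j', eeq (elt_of z u) (el z' k j').
Proof.
move=> M vu; have [j ej] := U_onto z vu; have [j' ej'] := M j; exists j'.
exact: eeq_trans ej'.
Qed.

Lemma match_root_entry k z z' p (b : bool) : level_match k z z' -> (erank p <= k)%N ->
  (b -> nilp p.2) -> exists p', heq (entry z p) (entry z' p') /\ (b -> nilp p'.2).
Proof.
move=> M pk bp; have [q [_ _ qm _ _]] := payload_exists [::] [:: b] [::] [::] 0.
have [|j' [e [es eh]]] := @match_code k z z' ([:: p], q) M.
  by rewrite /valid /marks_ok /= pk qm /= andbT; exact/implyP.
have := U_valid z' k j' => /andP[_ /andP[_]].
move: e es eh; rewrite /el; case: (U z' k j') => -[|p' [|]] //= ? <- _ /(_ 0) eh.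
rewrite qm /= andbT => /implyP bp'.
by exists p'.
Qed.

Lemma supported_transfer k z z' u : level_match k z' z -> valid k.+1 u ->
  supported root z k (elt_of z' u).
Proof.
move=> M vu; have [su Su] := valid_supported root_rk z' vu; split=> // j ju.
have tr p h : heq h (entry z' p) -> (rk h <= k)%N -> exists p', heq h (entry z p').
  move=> hp hk; have [||p' [pp' _]] := @match_root_entry k z' z p false M; rewrite //.
    by rewrite -(rk_entry root_rk z') -(heq_rk hp).
  by exists p'; exact: heq_trans pp'.
have [[r [p hp]]|[r H]] := Su j ju; first by left; split=> //; exact: tr hp r.
by right; split=> // i; have [p hp] := H i; apply: tr hp _; rewrite rk_hchild r.
Qed.

Lemma valid0_rk z u : valid 0 u -> forall i, rk (nth hset0 (elt_of z u).1 i) = 0.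
Proof.
move=> /andP[/allP H _] i; have [iu|ui] := ltnP i (size u.1); last first.
  by rewrite nth_default ?size_elt_of.
rewrite nth_elt_of // (rk_entry root_rk); apply/eqP; rewrite -leqn0; apply: H.
exact: mem_nth.
Qed.

Lemma dec_inj k z z' : cmp (level k (gs z)) (level k (gs z')) ->
  forall j j', cmp (dec k (gs z) j) (dec k (gs z') j') -> eeq (el z k j) (el z' k j').
Proof.
elim: k z z' => [|k IHk] z z' Hk j j'.
  move=> /kappa_inj e.
  have := U_valid z 0 j => v; have := U_valid z' 0 j' => v'.
  have /andP[_ /andP[/eqP s _]] := v; have /andP[_ /andP[/eqP s' _]] := v'.
  apply: (label_inj gen D0) => //; rewrite ?size_elt_of //; exact: valid0_rk.
move=> djj'; apply: contrapT => ne.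
have Hk' := level_down Hk.
have M w w' : cmp (level k (gs w)) (level k (gs w')) -> level_match k w w'.
  by move=> H i; have [Hw _] := H; have [i' ii'] := Hw i; exists i'; exact: (IHk w w').
have [| | | |w [wv _ _ _ wQ]] := @one_point_extension Z rho root root_rk z k [::]
    [:: (el z k.+1 j, true); (el z' k.+1 j', false)] [::] 0; rewrite //.
- move=> x; rewrite !inE => /orP[] /eqP ->; first exact: valid_supported.
  by apply: supported_transfer => //; apply: M; exact: cmp_sym.
- move=> x y; rewrite !inE => /orP[] /eqP -> /orP[] /eqP -> //= H.
  by case: (ne (eeq_sym H)).
have [i ei] := U_onto z wv.
have ij : gs z k.+1 i j.
  rewrite /generic_copy /= -(emem_eeq ei (eeq_refl _)).
  by apply: (wQ (_, _)); rewrite inE eqxx.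
have [i' [i'j' ii']] := dec_member djj' ij.
have ee := IHk z z' Hk' i i' ii'.
have := wQ (el z' k.+1 j', false); rewrite !inE eqxx orbT => /(_ isT) /=.
by rewrite (emem_eeq (eeq_trans ei ee) (eeq_refl _)) -[emem _ _]/(gs z' k.+1 i' j') i'j'.
Qed.

Lemma level_roots k z z' : cmp (level k (gs z)) (level k (gs z')) ->
  forall m, rho m = k -> exists m', rho m' = k /\ heq (root m z) (root m' z').
Proof.
move=> H m mk_; have M : level_match k z z'.
  by move=> j; have [H1 _] := H; have [j' jj'] := H1 j; exists j'; exact: dec_inj.
have [||[m' s'] [e /(_ isT)]] := @match_root_entry k z z' (m, [::]) true M; rewrite //.
  by rewrite /erank /= subn0 mk_.
case: s' e => // e _; exists m'; split=> //.
by rewrite -mk_ -(root_rk m z) -(root_rk m' z'); exact/esym/heq_rk.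
Qed.

Definition roots_match z z' := forall m, exists m', heq (root m z) (root m' z').

Lemma roots_match_level k z z' : roots_match z z' -> level_match k z z'.
Proof.
move=> M j.
have /choice[f Hf] p : exists p', heq (entry z p) (entry z' p') /\ (nilp p.2 -> nilp p'.2).
  case: p => m s; elim/last_ind: s => [|s i [[m' s'] [e _]]].
    by have [m' e] := M m; exists (m', [::]).
  have [i' ei] := heq_hchild e i; exists (m', rcons s' i').
  by rewrite !entry_rcons; split=> //; case: (s).
have /andP[Hr /andP[Hs Hm]] := U_valid z k j.
have [|j' ej'] := @U_onto z' k ([seq f p | p <- (U z k j).1], (U z k j).2).
  apply/andP; split.
    apply/allP => _ /mapP[p pu ->]; rewrite -(rk_entry root_rk z').
    have [e _] := Hf p; rewrite -(heq_rk e) (rk_entry root_rk); exact: (allP Hr).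
  rewrite /marks_ok /= size_map Hs /=.
  elim: ((U z k j).1) (marks (U z k j).2) Hm => [|p l IHl] [|b l'] //= /andP[/implyP Hb /IHl ->].
  by rewrite andbT; apply/implyP => /Hb; have [_] := Hf p; apply.
exists j'; apply: eeq_trans ej'; split=> //; split; first by rewrite /= !size_map.
move=> i; have [iu|ui] := ltnP i (size (U z k j).1).
  rewrite /el nth_elt_of // nth_elt_of ?size_map // (nth_map (0, [::])) //.
  by have [] := Hf (nth (0, [::]) (U z k j).1 i).
by rewrite !nth_default ?size_map //; exact: heq_refl.
Qed.

Lemma eeq_dec k z z' : roots_match z z' -> roots_match z' z ->
  forall j j', eeq (el z k j) (el z' k j') -> cmp (dec k (gs z) j) (dec k (gs z') j').
Proof.
elim: k z z' => [|k IHk] z z' M M' j j' e.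
  by congr (kappa _); apply/funext => i; exact: label_eeq.
have half w w' l l' : roots_match w w' -> roots_match w' w -> eeq (el w k.+1 l) (el w' k.+1 l') ->
    forall i, exists i', cmp ((dec k.+1 (gs w) l : nat -> plus_space k) i)
      ((dec k.+1 (gs w') l' : nat -> plus_space k) i').
  move=> Mw Mw' ell [|i] /=; first by exists 0; exact: cmp_refl.
  case: ifP => [il|_]; last by exists 0; exact: cmp_refl.
  have [i' ii'] := roots_match_level k Mw i; exists i'.+1.
  have -> : gs w' k.+1 i' l' = true.
    by rewrite /generic_copy /= -(emem_eeq ii' ell).
  exact: IHk.
split; first exact: half.
by move=> i; have [i' /cmp_sym H] := half _ _ _ _ M' M (eeq_sym e) i; exists i'.
Qed.

Lemma roots_level k z z' : roots_match z z' -> roots_match z' z ->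
  cmp (level k (gs z)) (level k (gs z')).
Proof.
have half w w' : roots_match w w' -> roots_match w' w ->
    forall j, exists j', cmp (dec k (gs w) j) (dec k (gs w') j').
  move=> M M' j; have [j' jj'] := roots_match_level k M j.
  by exists j'; exact: eeq_dec.
move=> M M'; split; first exact: half.
by move=> j; have [j' /cmp_sym ?] := half _ _ M' M j; exists j'.
Qed.

End Decoding.

Lemma reduction_into_comeager (Z : topologicalType) (rho : nat -> nat)
    (root : nat -> Z -> hset) (O : set lstruct) (D : nat -> set lstruct) :
  (forall m z, rk (root m z) = rho m) -> (forall m, borel_hset (root m)) ->
  open O -> O !=set0 -> (forall m, open (D m)) ->
  (forall m V, open V -> V !=set0 -> (V `&` D m) !=set0) ->
  exists f : Z -> lstruct, borel_fun f /\ (forall z, O (f z) /\ forall m, D m (f z)) /\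
    forall z z', (roots_match root z z' -> roots_match root z' z ->
      forall k, cmp (level k (f z)) (level k (f z'))) /\
    (forall k, cmp (level k (f z)) (level k (f z')) ->
      forall m, rho m = k -> exists m', rho m' = k /\ heq (root m z) (root m' z')).
Proof.
move=> rr rb oO [x0 Ox0] oD dD.
pose D' m := if m is m'.+1 then D m' else distinct_labels.
have [|g gen] := @generic_labels str D'.
  case=> [|m]; first exact: distinct_labels_dense.
  apply: open_dense_cylinders; [exact: oD|exact: dD].
have gen' : generic_for D' g := gen.
have [U [bU HU]] := generic_enumeration rr rb gen' oO Ox0.
exists (fun z => sgen root g z (U z)); split=> //.
have Uv z k j : valid rho k (U z k j) by have [_ _ + _] := HU z; apply.
have Uo z k u : valid rho k u -> exists j, eeq (elt_of root z u) (elt_of root z (U z k j)).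
  by have [_ _ _] := HU z; apply.
split=> [z|z z'].
  by have [Oz Dz _ _] := HU z; split=> // m; exact: (Dz m.+1).
split=> [M M' k|k]; first exact: (roots_level rr g Uv Uo).
exact: (level_roots rr gen' erefl Uv Uo).
Qed.

Lemma spectrum_from_reductions (X : topologicalType) (E : X -> X -> Prop)
    (psi : lstruct -> X) :
  Defs.equivalence_rel E -> borel_fun psi ->
  (forall (O : set lstruct) (D : nat -> set lstruct),
    open O -> O !=set0 -> (forall m, open (D m)) ->
    (forall m V, open V -> V !=set0 -> (V `&` D m) !=set0) ->
    exists f : X -> lstruct, borel_fun f /\ (forall x, O (f x) /\ forall m, D m (f x)) /\
      forall x x', E x x' <-> E (psi (f x)) (psi (f x'))) ->
  in_meager_spectrum E.
Proof.
move=> [Er [Es Et]] bpsi H.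
exists lstruct, (fun y y' => E (psi y) (psi y')).
split; first exact: polish_lstruct.
split; first by split=> [x|]; [exact: Er|split=> [x y|x y z]; [exact: Es|exact: Et]].
split.
  split; first by exists psi.
  have [||||f [bf [_ ef]]] := H setT (fun=> setT); first exact: openT.
  - by exists (fun _ _ _ => false).
  - by move=> _; exact: openT.
  - by move=> _ V _ [v Vv]; exists v.
  by exists f.
move=> C bC nC; have [ O [D [oO [neO [oD [dD OC]]]]]] := nonmeager_comeager bC nC.
split; first by exists id; split=> [|x y _ _]; [exact: borel_fun_id|split].
have [f [bf [fC ef]]] := H O D oO neO oD dD.
exists (f \o psi); split; first exact: borel_fun_comp.
split=> [y|x y]; last by rewrite ef.
by apply: OC; have [? ?] := fC (psi y); split.
Qed.

Theorem theorem1p8 :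
  (forall n : nat, (1 <= n)%N -> in_meager_spectrum (@eq_plus n)) /\
  in_meager_spectrum eq_plus_omega.
Proof.
split.
  case=> // k _.
  have [eqE eqP_] := eq_plusE k.+1.
  apply: (@spectrum_from_reductions (plus_space k.+1) (@eq_plus k.+1) (level k)) => //.
    exact: borel_level.
  move=> O D oO neO oD dD.
  pose root m (z : plus_space k.+1) : hset := existT _ k ((z : nat -> plus_space k) m).
  have [||f [bf [fC Hf]]] := @reduction_into_comeager (plus_space k.+1) (fun=> k) root O D
      _ _ oO neO oD dD.
  - by [].
  - move=> m; exists k, (fun z : plus_space k.+1 => (z : nat -> plus_space k) m); split=> //.
    exact: (@borel_coord _ (fun=> plus_space k) _ m (@borel_fun_id _)).
  exists f; split=> //; split=> // z z'.
  have [H1 H2] := Hf z z'; have [_ H2'] := Hf z' z.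
  rewrite !eq_plusP; split=> [[zz zz']|H].
    apply: H1 => m; first by have [m' ?] := zz m; exists m'.
    by have [m' ?] := zz' m; exists m'; exact: cmp_sym.
  split=> m; first by have [m' [_ ?]] := H2 k H m erefl; exists m'.
  by have [m' [_ /cmp_sym ?]] := H2' k (cmp_sym H) m erefl; exists m'.
pose psi (y : lstruct) : plus_omega_space := fun n =>
  if n is k.+1 then level k y else 0%R : R.
apply: (@spectrum_from_reductions plus_omega_space eq_plus_omega psi).
- split; first by move=> x n; have [[r _] _] := eq_plusE n; exact: r.
  split=> [x y xy n|x y z xy yz n]; have [[_ [s t]] _] := eq_plusE n; first exact: s.
  exact: t (xy n) (yz n).
- apply: (@borel_fun_prod lstruct plus_space) => [n|[|k]].
  + exact: countably_based_plus.
  + exact: borel_fun_cst.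
  + exact: borel_level.
move=> O D oO neO oD dD.
pose root m (z : plus_omega_space) : hset := existT _ m (z m).
have [||f [bf [fC Hf]]] := @reduction_into_comeager plus_omega_space id root O D
    _ _ oO neO oD dD.
- by [].
- move=> m; exists m, (fun z : plus_omega_space => z m); split=> //.
  exact: (@borel_coord _ plus_space _ m (@borel_fun_id _)).
exists f; split=> //; split=> // z z'.
have [H1 H2] := Hf z z'; split=> [zz [|k] //|H k].
  apply/eq_plusP; apply: H1 => m; exists m; first exact/eq_plusP.
  by apply: cmp_sym; exact/eq_plusP.
have [|m' [mk_ e]] := H2 k _ k erefl; first by apply/eq_plusP; exact: (H k.+1).
by apply/eq_plusP; rewrite /= in mk_; subst m'.
Qed.
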